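(* Let $\mathcal{A} \subseteq \mathcal{F}$ be a field of subsets of $\mathbb{N}$ and let $p \in [1,\infty)$. 1. If $\mathcal{N} \subseteq \overline{\mathcal{A}}$, then $\mathcal{K}_p(\mathcal{A}) \cong \mathcal{L}_p(\mathcal{A})$ with the isomorphism given by $[h]_{K_p(\mathcal{A})} \mapsto [h]_{L_p(\mathcal{A})}$ for each $h \in K_p(\mathcal{A})$. 2. The following statements are logically equivalent. (a) $\mathcal{L}_p(\mathcal{A}) \cong \mathcal{K}_p(\alpha(\mathcal{A} \cup \mathcal{N}))$ with the isomorphism mapping $[f]_{L_p(\mathcal{A})}$, for each $f \in L_p(\mathcal{A})$, to $[h]_{K_p(\alpha(\mathcal{A} \cup \mathcal{N}))}$, where $h$ is an element of $K_p(\alpha(\mathcal{A}\cup\mathcal{N}))$ such that $h = f$ a.e. with respect to $\alpha(\mathcal{A}\cup\mathcal{N})$, $\nu_N(|h|^p)$ converges as $N\to\infty$ with limit $\int |h|^p d\nu$, and $\nu_N(h)$ converges as $N\to\infty$ with limit $\int h\, d\nu$ (such an $h$ exists for every $f\in L_p(\mathcal{A})$). (b) $\overline{\alpha(\mathcal{A} \cup \mathcal{N})} = \alpha(\overline{\mathcal{A}} \cup \mathcal{N})$.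
   Context: $\mathbb{N} = \{1,2,3,\ldots\}$. For $f:\mathbb{N}\to\mathbb{R}$, $\nu_N(f) := \frac{1}{N}\sum_{n=1}^N f(n)$, $\nu^+(f) := \limsup_{N\to\infty}\nu_N(f)$, and $\nu(f) := \lim_{N\to\infty}\nu_N(f)$ when the limit exists. For $A\subseteq\mathbb{N}$ write $\nu(A) := \nu(I_A)$ with $I_A$ the indicator function. $\mathcal{F}$ is the collection of all $A\subseteq\mathbb{N}$ for which $\nu(A)$ exists, and $\mathcal{N} := \{A\in\mathcal{F}:\nu(A)=0\}$. $\alpha(\mathcal{C})$ is the smallest field of subsets of $\mathbb{N}$ containing the collection $\mathcal{C}$; if $\mathcal{A}\subseteq\mathcal{F}$ is a field then $\alpha(\mathcal{A}\cup\mathcal{N})$ is a field contained in $\mathcal{F}$. On a field $\mathcal{A}\subseteq\mathcal{F}$, $\nu$ is finitely additive. The following notions are defined for any field $\mathcal{A}\subseteq\mathcal{F}$ (and are applied to both $\mathcal{A}$ and $\alpha(\mathcal{A}\cup\mathcal{N})$). Peano–Jordan completion: $\overline{\mathcal{A}} := \{A\subseteq\mathbb{N} : \forall\epsilon>0\ \exists B,C\in\mathcal{A}$ with $B\subseteq A\subseteq C$ and $\nu(C\setminus B)<\epsilon\}$. Outer charge: $\nu^*(A) := \inf\{\nu(B) : B\in\mathcal{A}, A\subseteq B\}$. A function $f:\mathbb{N}\to\mathbb{R}$ is null (w.r.t. $\mathcal{A}$) if $\nu^*(\{|f|>\epsilon\})=0$ for all $\epsilon>0$; $f=g$ a.e.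 (w.r.t. $\mathcal{A}$) means $f-g$ is null. A simple function is a finite sum $\sum_k c_k I_{A_k}$ with $c_k\in\mathbb{R}$ and $\{A_k\}\subseteq\mathcal{A}$ a finite partition of $\mathbb{N}$; its integral is $\sum_k c_k\nu(A_k)$. $f_n\to f$ hazily if $\nu^*(\{|f_n-f|>\epsilon\})\to 0$ for every $\epsilon>0$. $f$ is $T_1$-measurable if it is a hazy limit of simple functions. $f$ is integrable if there are simple functions $f_n\to f$ hazily with $\int|f_n-f_m|\,d\nu\to 0$ as $n,m\to\infty$; then $\int f\,d\nu := \lim_n\int f_n\,d\nu$. $L_p(\mathcal{A})$ is the set of $T_1$-measurable $f:\mathbb{N}\to\mathbb{R}$ with $|f|^p$ integrable, with pseudonorm $(\int|f|^p d\nu)^{1/p}$; $\mathcal{L}_p(\mathcal{A})$ is its quotient by equality a.e., a normed space, and $[f]_{L_p(\mathcal{A})}$ is the class of $f$. $K_p(\mathcal{A})$ is the set of all $h:\mathbb{N}\to\mathbb{R}$ such that (i) there is a countable $C\subset\mathbb{R}$ with $h^{-1}(y,\infty)\in\overline{\mathcal{A}}$ for all $y\in\mathbb{R}\setminus C$; and (ii) for all $\epsilon>0$ there is $y\in(0,\infty)$ with $\nu^+(g I_{g^{-1}(y^p,\infty)})<\epsilon$, where $g:=|h|^p$. It is a vector subspace of $L_p(\mathcal{A})$ with pseudonorm $(\nu(|h|^p))^{1/p}$. $\mathcal{K}_p(\mathcal{A})$ is its quotient by equality a.e., a normed space, and $[h]_{K_p(\mathcal{A})}$ is the class of $h$. $\cong$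 denotes isometric (linear) isomorphism. *)

(* Defs.v *)
From HB Require Import structures.
From mathcomp Require Import all_boot all_order all_algebra.
From mathcomp Require Import all_classical all_reals all_analysis.

Set Implicit Arguments.
Unset Strict Implicit.
Unset Printing Implicit Defensive.

Import Order.TTheory GRing.Theory Num.Theory.
Import numFieldNormedType.Exports.

Local Open Scope classical_set_scope.
Local Open Scope ring_scope.

(* The set N = {1, 2, 3, ...}; [posS i] is the number i + 1. *)
Definition posnat : Type := {n : nat | (0 < n)%N}.
Definition posS (i : nat) : posnat := exist _ i.+1 isT.

Section density.
Variable R : realType.
Implicit Types (f : posnat -> R) (X : set posnat).

(* nu_N f = (f 1 + ... + f N) / N. The term N = 0 is junk, which no limit or
   limsup sees. *)
Definition avg f (N : nat) : R := (\sum_(i < N) f (posS i)) / N%:R.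

Definition nu_plus f : \bar R := limn_esup (fun N => (avg f N)%:E).

(* Meaningful only when [avg f] converges. *)
Definition nu f : R := limn (avg f).

Definition nuS X : R := nu \1_X.

Definition has_density : set (set posnat) :=
  [set X | cvgn (avg (\1_X : posnat -> R))].

Definition null_density : set (set posnat) :=
  [set X | has_density X /\ nuS X = 0].

End density.

Definition set_field (T : Type) (C : set (set T)) : Prop :=
  [/\ C set0, setC_closed C & setU_closed C].

Definition gen_field (T : Type) (C : set (set T)) : set (set T) :=
  smallest (@set_field T) C.

Section charge_space.
Variable R : realType.
Variable A : set (set posnat).
Implicit Types (f g h : posnat -> R) (X B C : set posnat).

Definition pj_completion : set (set posnat) :=
  [set X | forall e : R, 0 < e -> exists B C,
     [/\ A B, A C, B `<=` X, X `<=` C & nuS R (C `\` B) < e]].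

Definition outer_charge X : R := inf [set nuS R B | B in [set B | A B /\ X `<=` B]].

Definition null_function f : Prop :=
  forall e : R, 0 < e -> outer_charge [set x | e < `|f x|] = 0.

Definition eq_ae f g : Prop := null_function (f \- g).

(* f = sum_k c_k 1_{B_k}, with (B_k) a finite partition of N in A, and
   v = sum_k c_k nu(B_k). *)
Definition simple_with_integral f (v : R) : Prop :=
  exists (n : nat) (c : 'I_n -> R) (B : 'I_n -> set posnat),
    [/\ forall k, A (B k),
        trivIset setT B,
        \bigcup_k B k = setT,
        f = (fun x => \sum_(k < n) c k * \1_(B k) x)
      & v = \sum_(k < n) c k * nuS R (B k)].

Definition simple_function f : Prop := exists v, simple_with_integral f v.

(* The value v does not depend on the representation of f; 0 is the default
   value for a function that is not simple. *)
Definition simple_integral f : R := xget 0 [set v | simple_with_integral f v].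

Definition hazy_cvg (u : nat -> posnat -> R) f : Prop :=
  forall e : R, 0 < e ->
    outer_charge [set x | e < `|u n x - f x|] @[n --> \oo] --> (0 : R).

Definition T1_measurable f : Prop :=
  exists u : nat -> posnat -> R,
    (forall n, simple_function (u n)) /\ hazy_cvg u f.

Definition determining_sequence f (u : nat -> posnat -> R) : Prop :=
  [/\ forall n, simple_function (u n),
      hazy_cvg u f
    & simple_integral (fun x => `|u nm.1 x - u nm.2 x|)
        @[nm --> (\oo, \oo)] --> (0 : R)].

Definition charge_integrable f : Prop :=
  exists u, determining_sequence f u.

(* The limit does not depend on the determining sequence. *)
Definition charge_integral f : R :=
  xget 0 [set v | exists2 u, determining_sequence f u &
                    simple_integral (u n) @[n --> \oo] --> v].

Definition abs_pow (p : R) f : posnat -> R := fun x => `|f x| `^ p.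

Definition Lp (p : R) : set (posnat -> R) :=
  [set f | T1_measurable f /\ charge_integrable (abs_pow p f)].

Definition Lp_norm (p : R) f : R := charge_integral (abs_pow p f) `^ p^-1.

Definition Kp (p : R) : set (posnat -> R) :=
  [set h |
    (exists2 D : set R, countable D &
       forall y, ~ D y -> pj_completion [set x | y < h x])
    /\ (forall e : R, 0 < e -> exists2 y : R, 0 < y &
         let g := abs_pow p h in
         (nu_plus (fun x => (g x * \1_[set z | (y `^ p < g z)%R] x)%R) < e%:E)%E)].

Definition Kp_norm (p : R) h : R := nu (abs_pow p h) `^ p^-1.

End charge_space.

(* A pseudonormed space of real functions on N, together with the equivalence
   relation by which it is to be divided. *)
Record fun_space (R : realType) := FunSpace {
  fs_set : set (posnat -> R);
  fs_eq : (posnat -> R) -> (posnat -> R) -> Prop;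
  fs_norm : (posnat -> R) -> R }.

Definition LpS (R : realType) (A : set (set posnat)) (p : R) : fun_space R :=
  FunSpace (Lp A p) (@eq_ae R A) (Lp_norm A p).

Definition KpS (R : realType) (A : set (set posnat)) (p : R) : fun_space R :=
  FunSpace (Kp A p) (@eq_ae R A) (Kp_norm p).

Section quotient.
Variable R : realType.
Implicit Types (E : fun_space R) (f g h : posnat -> R).
Implicit Types c d : set (posnat -> R).

Definition class_of E f : set (posnat -> R) := [set g | fs_set E g /\ fs_eq E g f].

Definition quot E : set (set (posnat -> R)) := [set class_of E f | f in fs_set E].

(* The structure of the quotient normed space: [f] + [g] = [f + g],
   a [f] = [a f], and the norm of [f] is the pseudonorm of f. *)
Definition quot_add E c d : set (posnat -> R) :=
  [set h | fs_set E h /\ exists f g, [/\ c f, d g & fs_eq E h (f \+ g)]].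

Definition quot_scale E (a : R) c : set (posnat -> R) :=
  [set h | fs_set E h /\ exists2 f, c f & fs_eq E h (a \*: f)].

Definition quot_norm E c : R := fs_norm E (xget (fun=> 0) c).

(* [Phi] is relevant only on [quot E]. *)
Record isometric_iso E F (Phi : set (posnat -> R) -> set (posnat -> R)) : Prop := {
  iso_bij : set_bij (quot E) (quot F) Phi;
  iso_add : forall c d, quot E c -> quot E d ->
    Phi (quot_add E c d) = quot_add F (Phi c) (Phi d);
  iso_scale : forall a c, quot E c ->
    Phi (quot_scale E a c) = quot_scale F a (Phi c);
  iso_norm : forall c, quot E c -> quot_norm F (Phi c) = quot_norm E c }.

End quotient.

(* Main.v *)
Require Import Defs.
From mathcomp Require Import all_boot all_order all_algebra.
From mathcomp Require Import all_classical all_reals all_analysis.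
Import Order.TTheory GRing.Theory Num.Theory.
Import numFieldNormedType.Exports.
From mathcomp Require Import ring lra.
Local Open Scope classical_set_scope.
Local Open Scope ring_scope.
Set Implicit Arguments.
Unset Strict Implicit.
Unset Printing Implicit Defensive.

(** Everything rests on a description of the two kinds of spaces in which the
    integral no longer occurs.

    - [KpP]: [h] lies in [Kp] exactly when it is a hazy limit of simple functions
      and [|h|^p] is uniformly integrable with respect to upper averages.
    - [LpP]: [f] lies in [Lp] exactly when it is a hazy limit of simple functions
      and there is an [h] with [|h|^p] uniformly integrable such that the sets
      where [|f - h|] exceeds a positive constant have density zero; and then the
      averages of [|h|^p] converge to the integral of [|f|^p].

    For [KpP], a hazy limit has almost all its level sets in the completion
    because the outer charge of the sets [f > y] is monotone in [y] and has
    countably many jumps ([measurable1_levels]); conversely staircases built on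
    level sets are simple functions ([staircase]). For [LpP], truncation shows
    that averages of [h] compute the integral of [f] ([mean_approx_unif]), and
    the function [h] is produced by the completeness of the space of functions
    with upper mean of the absolute value as seminorm ([mean_complete]): a
    determining sequence of [|f|^p] has a limit there.

    If the sets of density zero lie in the completion of [A], equality up to
    density zero is equality almost everywhere. The function [h] attached to [f]
    is then almost everywhere equal to [f], hence lies in [Kp], and the first
    part follows.

    Let [A'] be generated by [A] and the sets of density zero: its elements are
    the sets that differ from an element of [A] by a set of density zero. Sending
    [f] in [Lp] over [A] to the class of such an [h] is always well defined,
    isometric and injective, since on functions measurable over [A] the two
    notions of equality agree ([measurable1_deq_eq_ae]). The question is
    surjectivity. If the completion of [A'] is obtained from that of [A] by
    adding the sets of density zero, the staircases of an element of [Kp] over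
    [A'] can be corrected into simple functions over the completion of [A], and
    a careful choice of the corrections converges ([measurable1_lift]).
    Conversely, surjectivity applied to the indicator of a set of the completion
    of [A'] gives a measurable function over [A], one of whose level sets differs
    from the given set by a set of density zero ([pj_null_ext_eq]). *)

(** * Averages and density *)

Section averages.
Variable R : realType.
Implicit Types (f g h : posnat -> R) (X Y : set posnat) (c d e l : R).

(** [avg_le f c] stands for the bound nu^+(f) <= c up to an arbitrarily small
    loss; it is additive in [f] and needs no extended reals. *)
Definition avg_le f c := \forall N \near \oo, avg f N <= c.

(** The same sets as [null_density], see [null_densityE]; an upper bound on the
    averages is all that has to be checked, and it passes to subsets. *)
Definition dnull X := forall e, 0 < e -> avg_le \1_X e.

(** Equality up to sets of density zero, but only at each resolution [e]:
    the set where [f] and [h] differ may have positive density. *)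
Definition deq f h := forall e, 0 < e -> dnull [set x | e < `|f x - h x|].

(** For [f = |h|^p] this is the tail condition in the definition of [Kp]. *)
Definition unif_integrable f := forall e, 0 < e ->
  exists M, avg_le (fun x => `|f x| * \1_[set z | M < `|f z|] x) e.

Lemma avgD f g N : avg (f \+ g) N = avg f N + avg g N.
Proof. by rewrite /avg big_split mulrDl. Qed.

Lemma avgZ c f N : avg (fun x => c * f x) N = c * avg f N.
Proof. by rewrite /avg -mulr_sumr mulrA. Qed.

Lemma avg_sum (I : Type) (r : seq I) (F : I -> posnat -> R) N :
  avg (fun x => \sum_(k <- r) F k x) N = \sum_(k <- r) avg (F k) N.
Proof. by rewrite /avg exchange_big mulr_suml. Qed.

Lemma ler_avg f g N : (forall x, f x <= g x) -> avg f N <= avg g N.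
Proof.
move=> fg; rewrite /avg ler_wpM2r ?invr_ge0 ?ler0n//.
by apply: ler_sum => i _; exact: fg.
Qed.

Lemma avg_ge0 f N : (forall x, 0 <= f x) -> 0 <= avg f N.
Proof. by move=> f0; rewrite mulr_ge0 ?invr_ge0 ?ler0n ?sumr_ge0. Qed.

Lemma avg_cst_le c N : 0 <= c -> avg (fun=> c) N <= c.
Proof.
move=> c0; rewrite /avg sumr_const card_ord.
case: N => [|N]; first by rewrite mulr0n mul0r.
by rewrite -[c *+ _]mulr_natr mulfK// pnatr_eq0.
Qed.

Lemma avg_norm_sub f g N : `|avg f N - avg g N| <= avg (fun x => `|f x - g x|) N.
Proof.
rewrite /avg -mulrBl normrM [X in _ * X]ger0_norm ?invr_ge0 ?ler0n//.
by rewrite ler_wpM2r ?invr_ge0 ?ler0n// -sumrB; exact: ler_norm_sum.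
Qed.

Lemma indicT X x : X x -> \1_X x = 1 :> R.
Proof. by move=> Xx; rewrite indicE mem_set. Qed.

Lemma indicF X x : ~ X x -> \1_X x = 0 :> R.
Proof. by move=> Xx; rewrite indicE memNset. Qed.

Lemma indic_ge0 X x : 0 <= \1_X x :> R.
Proof. by rewrite indicE ler0n. Qed.

Lemma ler_indic X Y x : X `<=` Y -> \1_X x <= \1_Y x :> R.
Proof.
move=> XY; have [Xx|Xx] := pselect (X x); first by rewrite !indicT//; exact: XY.
by rewrite (indicF Xx) indic_ge0.
Qed.

Lemma ler_indicU X Y x : \1_(X `|` Y) x <= \1_X x + \1_Y x :> R.
Proof.
have [Xx|Xx] := pselect (X x).
  by rewrite !(@indicT _ _ (or_introl Xx)) (indicT Xx) lerDl indic_ge0.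
rewrite (indicF Xx) add0r; have [Yx|Yx] := pselect (Y x).
  by rewrite (indicT Yx) (@indicT (X `|` Y)) //; right.
by rewrite (indicF Yx) (@indicF (X `|` Y)) // => -[].
Qed.

Lemma le_avg_le f g c d :
  (forall x, f x <= g x) -> c <= d -> avg_le g c -> avg_le f d.
Proof.
move=> fg cd; apply: filterS => N /(le_trans _) gN.
exact: le_trans (gN _ (ler_avg N fg)) cd.
Qed.

Lemma avg_leD f g c d : avg_le f c -> avg_le g d -> avg_le (f \+ g) (c + d).
Proof. by apply: filterS2 => N fc gd; rewrite avgD lerD. Qed.

Lemma avg_leZ c f d : 0 <= c -> avg_le f d -> avg_le (fun x => c * f x) (c * d).
Proof. by move=> c0; apply: filterS => N fd; rewrite avgZ ler_wpM2l. Qed.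

Lemma avg_le_cst c : 0 <= c -> avg_le (fun=> c) c.
Proof. by move=> c0; apply: nearW => N; exact: avg_cst_le. Qed.

Lemma avg_le_ge0 f c : (forall x, 0 <= f x) -> avg_le f c -> 0 <= c.
Proof.
move=> f0 /filter_ex [N]; apply: le_trans; exact: avg_ge0.
Qed.

Lemma avg_le_cvg f l c : avg f @ \oo --> l -> l < c -> avg_le f c.
Proof. by move=> fl lc; apply: filterS (cvgr_lt _ fl _ lc) => N /ltW. Qed.

Lemma cvg_avg_le f l c : avg f @ \oo --> l -> avg_le f c -> l <= c.
Proof.
move=> fl fc; rewrite -(cvg_lim (@Rhausdorff R) fl).
by apply: limr_le => //; apply/cvg_ex; exists l.
Qed.

Lemma avg_le_indicU X Y c d :
  avg_le \1_X c -> avg_le \1_Y d -> avg_le \1_(X `|` Y) (c + d).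
Proof.
move=> Xc Yd; apply: le_avg_le (avg_leD Xc Yd) => // x; exact: ler_indicU.
Qed.

Lemma avg_le_indic_sub X Y c d :
  X `<=` Y -> c <= d -> avg_le \1_Y c -> avg_le \1_X d.
Proof. by move=> XY cd; apply: le_avg_le => // x; exact: ler_indic. Qed.

Lemma avg_le_markov f c e : 0 < e -> avg_le (fun x => `|f x|) c ->
  avg_le \1_[set x | e < `|f x|] (c / e).
Proof.
move=> e0 /(avg_leZ (_ : 0 <= e^-1)); rewrite invr_ge0 (ltW e0) => /(_ isT).
apply: le_avg_le => [x|]; last by rewrite mulrC.
have [ex|ex] := pselect (e < `|f x|).
  by rewrite indicT// mulrC ler_pdivlMr// mul1r ltW.
by rewrite indicF// mulr_ge0// invr_ge0 ltW.
Qed.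

Lemma approx_cvgn (u : nat -> R) :
  (forall e, 0 < e -> exists l, \forall n \near \oo, `|u n - l| <= e) -> cvgn u.
Proof.
move=> ul; apply/cauchy_cvgP/cauchy_exP => e e0.
have e2 : 0 < e / 2 by rewrite divr_gt0.
have [l ln] := ul _ e2; exists l.
apply: filterS ln => n; rewrite /ball/= distrC => /le_lt_trans; apply.
by rewrite ltr_pdivrMr// ltr_pMr// ltr1n.
Qed.

Lemma cvg_has_density X : has_density R X -> avg (\1_X : posnat -> R) @ \oo --> nuS R X.
Proof. by []. Qed.

Lemma nuS_avg_le X c : has_density R X -> nuS R X < c -> avg_le \1_X c.
Proof. by move=> /cvg_has_density /avg_le_cvg; apply. Qed.

Lemma avg_le_nuS X c : has_density R X -> avg_le \1_X c -> nuS R X <= c.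
Proof. by move=> /cvg_has_density /cvg_avg_le; apply. Qed.

Lemma nuS_ge0 X : has_density R X -> 0 <= nuS R X.
Proof.
move=> /cvg_has_density Xl; rewrite leNgt; apply/negP => n0.
have /(avg_le_cvg Xl)/(avg_le_ge0 (indic_ge0 X)) : nuS R X < nuS R X / 2 by lra.
by apply/negP; rewrite -ltNge; lra.
Qed.

End averages.

Section density_null.
Variable R : realType.
Implicit Types (f g h : posnat -> R) (X Y : set posnat) (c d e l M : R).

Lemma null_densityE X : null_density R X <-> dnull R X.
Proof.
split=> [[dX X0] e e0|X0]; first by apply: nuS_avg_le; rewrite // X0.
suff X0' : avg (\1_X : posnat -> R) @ \oo --> (0 : R).
  split; first by apply/cvg_ex; exists 0.
  exact: (cvg_lim (@Rhausdorff R) X0').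
apply/cvgrPdist_le => e e0; apply: filterS (X0 _ e0) => N.
by rewrite sub0r normrN ger0_norm// avg_ge0// => x; exact: indic_ge0.
Qed.

Lemma dnullS X Y : X `<=` Y -> dnull R Y -> dnull R X.
Proof. by move=> XY Y0 e /Y0; exact: avg_le_indic_sub. Qed.

Lemma dnullU X Y : dnull R X -> dnull R Y -> dnull R (X `|` Y).
Proof.
move=> X0 Y0 e e0; rewrite [e]splitr.
by apply: avg_le_indicU; [apply: X0|apply: Y0]; rewrite divr_gt0.
Qed.

Lemma dnull_set0 : dnull R set0.
Proof.
move=> e e0; apply: le_avg_le (avg_le_cst (ltW e0)) => // x.
by rewrite indicF// ltW.
Qed.

Lemma deq_refl f : deq f f.
Proof.
move=> e e0; apply: dnullS dnull_set0 => x /=.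
by rewrite subrr normr0 => /(lt_trans e0); rewrite ltxx.
Qed.

Lemma deq_sym f g : deq f g -> deq g f.
Proof. by move=> fg e /fg; apply: dnullS => x /=; rewrite distrC. Qed.

Lemma deqD f f' g g' : deq f f' -> deq g g' -> deq (f \+ g) (f' \+ g').
Proof.
move=> ff' gg' e e0; have e2 : 0 < e / 2 by rewrite divr_gt0.
apply: dnullS (dnullU (ff' _ e2) (gg' _ e2)) => x /= efh.
apply: contrapT => /not_orP[/negP + /negP]; rewrite -!leNgt => fgx ghx.
move: efh; rewrite ltNge => /negP; apply.
have := ler_normD (f x - f' x) (g x - g' x).
by rewrite [X in `|X|](_ : _ = f x + g x - (f' x + g' x)); [lra|ring].
Qed.

Lemma deqZ c f g : deq f g -> deq (c \*: f) (c \*: g).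
Proof.
move=> fg e e0; have [->|c0] := eqVneq c 0.
  apply: dnullS dnull_set0 => x /=.
  by rewrite !scale0r subrr normr0 => /(lt_trans e0); rewrite ltxx.
apply: dnullS (fg (e / `|c|) _); last by rewrite divr_gt0// normr_gt0.
move=> x /=; rewrite -scalerBr normrM => ec.
by rewrite ltr_pdivrMr ?normr_gt0// mulrC.
Qed.

Lemma unif_integrable_le f g : (forall x, `|f x| <= `|g x|) ->
  unif_integrable g -> unif_integrable f.
Proof.
move=> fg ug e /ug[M Mg]; exists M; apply: le_avg_le Mg => // x.
have [Mx|Mx] := pselect (M < `|f x|); last first.
  by rewrite indicF// mulr0 mulr_ge0// indic_ge0.
by rewrite !indicT ?mulr1//=; exact: lt_le_trans (fg x).
Qed.

(** Raising the threshold only shrinks the tail, so it can be taken beyond any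
    bound prescribed by another estimate. *)
Lemma unif_integrable_ge g e M0 : unif_integrable g -> 0 < e ->
  exists2 M, M0 <= M & avg_le (fun x => `|g x| * \1_[set z | M < `|g z|] x) e.
Proof.
move=> ug /ug[M Mg]; exists (Num.max M0 M); first by rewrite le_max lexx.
apply: le_avg_le Mg => // x; rewrite ler_wpM2l//.
by apply: ler_indic => z /=; apply: le_lt_trans; rewrite le_max lexx orbT.
Qed.

Lemma unif_integrableZ c f : unif_integrable f ->
  unif_integrable (fun x => c * f x).
Proof.
move=> uf; have [->|c0] := eqVneq c 0.
  move=> e e0; exists 0; apply: le_avg_le (avg_le_cst (ltW e0)) => // x.
  by rewrite mul0r normr0 mul0r ltW.
move=> e e0; have c0' : 0 < `|c| by rewrite normr_gt0.
have [M /(avg_leZ (normr_ge0 c)) fM] := uf _ (divr_gt0 e0 c0').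
exists (`|c| * M); apply: le_avg_le fM => [x|]; last by rewrite mulrC divfK ?gt_eqF.
rewrite normrM -mulrA ler_wpM2l// ler_wpM2l//.
by apply: ler_indic => z /=; rewrite normrM ltr_pM2l.
Qed.

Lemma unif_integrableD f g : unif_integrable f -> unif_integrable g ->
  unif_integrable (f \+ g).
Proof.
move=> uf ug e e0; have e4 : 0 < e / 4 by rewrite divr_gt0.
have [M M1 fM] := unif_integrable_ge 1 uf e4.
have [M' M1' gM] := unif_integrable_ge M ug e4.
have [M'' M1'' fM''] := unif_integrable_ge M' uf e4.
pose L := Num.max M' M''.
have fL : avg_le (fun x => `|f x| * \1_[set z | L < `|f z|] x) (e / 4).
  apply: le_avg_le fM'' => // x; rewrite ler_wpM2l//.
  by apply: ler_indic => z /=; apply: le_lt_trans; rewrite le_max lexx orbT.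
have gL : avg_le (fun x => `|g x| * \1_[set z | L < `|g z|] x) (e / 4).
  apply: le_avg_le gM => // x; rewrite ler_wpM2l//.
  by apply: ler_indic => z /=; apply: le_lt_trans; rewrite le_max lexx.
exists (2 * L); apply: le_avg_le (avg_leZ (_ : 0 <= 2) (avg_leD fL gL)) => //=; last first.
  lra.
move=> x; have [Mx|Mx] := pselect (2 * L < `|f x + g x|); last first.
  by rewrite indicF// mulr0 mulr_ge0// addr_ge0// mulr_ge0// indic_ge0.
have nD := ler_normD (f x) (g x).
(* the larger of the two summands exceeds L and carries half of the sum *)
rewrite indicT// mulr1; have [fg|gf] := leP `|f x| `|g x|.
  rewrite (@indicT _ [set z | L < `|g z|]) /=; last by lra.
  have : 0 <= `|f x| * \1_[set z | L < `|f z|] x by rewrite mulr_ge0// indic_ge0.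
  by lra.
rewrite (@indicT _ [set z | L < `|f z|]) /=; last by lra.
have : 0 <= `|g x| * \1_[set z | L < `|g z|] x by rewrite mulr_ge0// indic_ge0.
by lra.
Qed.

End density_null.

Section set_fields.
Variables (T : Type) (C : set (set T)).
Hypothesis Cfield : set_field C.

Lemma set_field0 : C set0. Proof. by case: Cfield. Qed.
Lemma set_fieldC X : C X -> C (~` X). Proof. by case: Cfield => _ + _; apply. Qed.
Lemma set_fieldU X Y : C X -> C Y -> C (X `|` Y).
Proof. by case: Cfield => _ _; apply. Qed.
Lemma set_fieldT : C setT. Proof. by rewrite -setC0; exact/set_fieldC/set_field0. Qed.
Lemma set_fieldI X Y : C X -> C Y -> C (X `&` Y).
Proof.
by move=> CX CY; rewrite -[X `&` Y]setCK setCI; apply/set_fieldC/set_fieldU; exact: set_fieldC.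
Qed.
Lemma set_fieldD X Y : C X -> C Y -> C (X `\` Y).
Proof. by move=> CX CY; rewrite setDE; apply: set_fieldI => //; exact: set_fieldC. Qed.

Lemma set_field_bigcup (I : choiceType) (D : set I) (F : I -> set T) : finite_set D ->
  (forall i, D i -> C (F i)) -> C (\bigcup_(i in D) F i).
Proof.
move=> fD CF; rewrite -bigsetU_fset_set// big_seq.
elim/big_ind : _ => [|X Y|i]; [exact: set_field0|exact: set_fieldU|].
by rewrite in_fset_set// inE => /CF.
Qed.

End set_fields.

(** * Simple functions and the outer charge *)

Section simple_functions.
Variable R : realType.
Implicit Types (f g h s : posnat -> R) (X Y D : set posnat) (c d e l M : R).

Definition density_field (A : set (set posnat)) :=
  set_field A /\ A `<=` has_density R.

(** Simple functions, described without a partition: this form is visibly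
    stable under every pointwise operation. *)
Definition simple (A : set (set posnat)) f :=
  finite_set (range f) /\ forall P : set R, A (f @^-1` P).

Variable A : set (set posnat).
Hypothesis dA : density_field A.
Let fA : set_field A := dA.1.
Let hA : A `<=` has_density R := dA.2.

Lemma simple_op (op : R -> R) f : simple A f -> simple A (op \o f).
Proof.
move=> [ff Af]; split; last by move=> P; rewrite comp_preimage; exact: Af.
by have := finite_image op ff; rewrite image_comp.
Qed.

Lemma simple_op2 (op : R -> R -> R) f g : simple A f -> simple A g ->
  simple A (fun x => op (f x) (g x)).
Proof.
move=> [ff Af] [fg Ag]; split.
  apply: sub_finite_set (finite_image2 op ff fg) => _ [x _ <-].
  by exists (f x); [exists x|exists (g x); [exists x|]].
move=> P; pose I := (range f `*` range g) `&` [set ab | P (op ab.1 ab.2)].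
rewrite (_ : _ @^-1` P = \bigcup_(ab in I) ((f @^-1` [set ab.1]) `&` (g @^-1` [set ab.2]))).
  apply: set_field_bigcup => //; last by move=> ab _; exact: set_fieldI.
  by apply: finite_setIl; exact: finite_setX.
apply/seteqP; split=> [x Px|x [[a b] /= [_ Pab] [fx gx]]]; last by rewrite fx gx.
by exists (f x, g x) => //; split => //; split; exists x.
Qed.

Lemma simple_cst c : simple A (cst c).
Proof.
split; first by apply: sub_finite_set (finite_set1 c) => _ [x _ <-].
move=> P; have [Pc|Pc] := pselect (P c).
  by rewrite preimage_cst mem_set//; exact: set_fieldT.
by rewrite preimage_cst memNset//; exact: set_field0.
Qed.

Lemma simple_indic X : A X -> simple A \1_X.
Proof.
move=> AX; split.
  apply: sub_finite_set (finite_set2 0 1) => _ [x _ <-].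
  by rewrite indicE; case: (_ \in _); [right|left].
move=> P; rewrite preimage_indic; case: ifP => _; case: ifP => _ //.
- exact: set_fieldT.
- exact: set_fieldC.
- exact: set_field0.
Qed.

Lemma simple_sum n (F : 'I_n -> posnat -> R) : (forall k, simple A (F k)) ->
  simple A (fun x => \sum_(k < n) F k x).
Proof.
move=> sF; elim: n F sF => [|n IH] F sF.
  by under eq_fun do rewrite big_ord0; exact: simple_cst.
by under eq_fun do rewrite big_ord_recl; apply: simple_op2 => //; exact: IH.
Qed.

Lemma simple_bounded f : simple A f -> exists2 M, 0 <= M & forall x, `|f x| <= M.
Proof.
move=> [/finite_seqP[s fs] _]; exists (\sum_(y <- s) `|y|); first exact: sumr_ge0.
move=> x; have : [set` s] (f x) by rewrite -fs; exists x.
move=> /= xs; rewrite (big_rem _ xs)/= lerDl; exact: sumr_ge0.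
Qed.

Lemma simpleP f : simple_function A f <-> simple A f.
Proof.
split=> [[v [n [c [B [AB tB cB -> _]]]]]|[/finite_seqP[s fs] Af]].
  apply: simple_sum => k; apply: (simple_op2 *%R) (simple_indic (AB k)).
  exact: simple_cst.
pose c (k : 'I_(size (undup s))) := nth 0 (undup s) k.
have cE x : exists k, f x = c k.
  have : [set` s] (f x) by rewrite -fs; exists x.
  rewrite /= -mem_undup => xs; rewrite -index_mem in xs.
  by exists (Ordinal xs); rewrite /c/= nth_index// -index_mem.
have c_inj (k l : 'I_(size (undup s))) : c k = c l -> k = l.
  by move/eqP; rewrite nth_uniq ?undup_uniq// => /eqP/val_inj.
eexists; exists (size (undup s)), c, (fun k => f @^-1` [set c k]); split => //.
- by move=> k k' _ _ [x [/= -> /c_inj]].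
- by rewrite -subTset => x _; have [k fx] := cE x; exists k.
- apply/funext => x; have [k fx] := cE x.
  rewrite (bigD1 k)//= indicT//= mulr1 big1 ?addr0// => l lk.
  rewrite indicF ?mulr0//= fx => /c_inj kl.
  by rewrite kl eqxx in lk.
Qed.

Lemma simple_with_integral_cvg f v : simple_with_integral A f v ->
  avg f @ \oo --> v.
Proof.
move=> [n [c [B [AB _ _ -> ->]]]].
rewrite [avg _](_ : _ = fun N => \sum_(k < n) c k * avg \1_(B k) N); last first.
  by apply/funext => N; rewrite avg_sum; apply: eq_bigr => k _; rewrite avgZ.
apply: (cvg_big add_continuous) => k _; apply: cvgMr; apply: cvg_has_density.
exact: hA.
Qed.

Lemma simple_integral_cvg f : simple A f -> avg f @ \oo --> simple_integral A f.
Proof.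
move=> /simpleP fs; apply: simple_with_integral_cvg.
by rewrite /simple_integral; case: xgetP => [v -> //|/(_ _)fv]; case: fs => v /fv.
Qed.

Lemma outer_ltP X e :
  outer_charge R A X < e <-> exists D, [/\ A D, X `<=` D & nuS R D < e].
Proof.
split=> [/inf_lt[]|[D [AD XD De]]].
- by exists (nuS R setT), setT => //; split; [exact: set_fieldT|].
- by move=> _ [D [AD XD] <-] De; exists D.
apply: le_lt_trans De; apply: ge_inf; last by exists D.
by exists 0 => _ [B [AB _] <-]; apply: nuS_ge0; exact: hA.
Qed.

Lemma outer_ge0 X : 0 <= outer_charge R A X.
Proof.
apply: lb_le_inf; first by exists (nuS R setT), setT => //; split; [exact: set_fieldT|].
by move=> _ [B [AB _] <-]; apply: nuS_ge0; exact: hA.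
Qed.

Lemma null_functionP f : null_function A f <-> forall e d, 0 < e -> 0 < d ->
  exists D, [/\ A D, nuS R D < d & forall x, ~ D x -> `|f x| <= e].
Proof.
split=> [f0 e d e0 d0|fD e e0].
  have /outer_ltP[D [AD XD Dd]] : outer_charge R A [set x | e < `|f x|] < d by rewrite f0.
  by exists D; split => // x Dx; rewrite leNgt; apply/negP => /XD.
apply/eqP; rewrite eq_le outer_ge0 andbT; apply/ler_addgt0Pl => d d0; rewrite addr0.
have [D [AD Dd XD]] := fD _ _ e0 d0; apply/ltW/outer_ltP; exists D; split => // x /= ex.
by apply: contrapT => /XD; rewrite leNgt ex.
Qed.

Lemma hazy_cvgP (u : nat -> posnat -> R) f : hazy_cvg A u f <->
  forall e d, 0 < e -> 0 < d -> \forall n \near \oo,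
  exists D, [/\ A D, nuS R D < d & forall x, ~ D x -> `|u n x - f x| <= e].
Proof.
split=> [uf e d e0 d0|uf e e0].
  apply: filterS (cvgr_lt _ (uf _ e0) _ d0) => n /outer_ltP[D [AD XD Dd]].
  by exists D; split => // x Dx; rewrite leNgt; apply/negP => /XD.
apply/cvgrPdist_le => d d0; apply: filterS (uf _ _ e0 d0) => n [D [AD Dd XD]].
rewrite sub0r normrN ger0_norm ?outer_ge0//; apply/ltW/outer_ltP.
by exists D; split => // x /= ex; apply: contrapT => /XD; rewrite leNgt ex.
Qed.

(** Closeness in the Ky Fan sense; the exceptional set is taken from [A]. *)
Definition near_simple f e s := simple A s /\
  exists D, [/\ A D, nuS R D < e & forall x, ~ D x -> `|s x - f x| <= e].

(** Hazy approximability by simple functions, see [T1_measurableP]. *)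
Definition measurable1 f := forall e, 0 < e -> exists s, near_simple f e s.

Lemma invS_gt0 (n : nat) : 0 < n.+1%:R^-1 :> R.
Proof. by rewrite invr_gt0 ltr0n. Qed.

Lemma near_simple_hazy (u : nat -> posnat -> R) f :
  (forall n, near_simple f n.+1%:R^-1 (u n)) -> hazy_cvg A u f.
Proof.
move=> uf; apply/hazy_cvgP => e d e0 d0.
have : \forall n \near \oo, n.+1%:R^-1 < Num.min e d :> R.
  have m0 : 0 < Num.min e d by rewrite lt_min e0.
  exact: (near_infty_natSinv_lt (PosNum m0)).
apply: filterS => n; rewrite lt_min => /andP[ne nd].
have [_ [D [AD Dn Df]]] := uf n; exists D; split => //; first exact: lt_trans nd.
by move=> x /Df /le_trans; apply; exact: ltW.
Qed.

Lemma T1_measurableP f : T1_measurable A f <-> measurable1 f.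
Proof.
split=> [[u [us uf]] e e0|fm].
  have /hazy_cvgP/(_ _ _ e0 e0)/filter_ex[n [D [AD De Df]]] := uf.
  by exists (u n); split; [exact/simpleP|exists D].
have /choice[u uf] (n : nat) := fm _ (invS_gt0 n).
exists u; split; first by move=> n; apply/simpleP; exact: (uf n).1.
exact: near_simple_hazy.
Qed.

End simple_functions.

(** * Measurable functions: completion, limits and composition *)

Section uniform_continuity.
Variable R : realType.

(** Heine's theorem, with one of the two points allowed to leave the ball. *)
Lemma unif_continuous_ball (phi : R -> R) (M e : R) : continuous phi -> 0 < e ->
  exists2 d : R, 0 < d &
    forall x y, `|x| <= M -> `|x - y| <= d -> `|phi x - phi y| <= e.
Proof.
move=> cphi e0.
have /compact_near_coveringP cM : compact `[- M, M]%classic by exact: segment_compact.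
pose P (d x : R) := forall y, `|x - y| <= d -> `|phi x - phi y| <= e.
have e2 : 0 < e / 2 by rewrite divr_gt0.
have Ploc x : `[- M, M]%classic x -> \forall x' \near x & d \near 0^'+, P d x'.
  move=> _; have /cvgrPdist_le/(_ _ e2)/nbhs_ballP[r /= r0 phir] := cphi x.
  have r2 : 0 < r / 2 by rewrite divr_gt0.
  exists (ball x (r / 2), [set d | d < r / 2]) => /=.
    by split; [exact: nbhsx_ballx|exact: nbhs_right_lt].
  move=> [x' d] /= [xx' dr] y x'y.
  rewrite [e]splitr; apply: le_trans (ler_distD (phi x) _ _) _.
  rewrite lerD//; last first.
    apply: phir; rewrite /ball/=; apply: le_lt_trans (ler_distD x' _ _) _.
    by rewrite [r]splitr ltr_leD//; apply: le_trans x'y _; exact: ltW.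
  rewrite distrC; apply: phir; rewrite /ball/=; apply: lt_trans xx' _.
  by rewrite ltr_pdivrMr// ltr_pMr// ltr1n.
have Pd : \forall d \near 0^'+, `[- M, M]%classic `<=` P d by exact: cM.
near (0 : R)^'+ => d.
have KP : `[- M, M]%classic `<=` P d by near: d.
exists d => // x y xM; apply: KP.
by rewrite /= in_itv/=; move: xM; rewrite ler_norml.
Unshelve. all: by end_near. Qed.

End uniform_continuity.

Section measurable_functions.
Variable R : realType.
Implicit Types (f g h s : posnat -> R) (X Y D : set posnat) (c d e l M : R).

Lemma nuS_leU X Y Z : has_density R X -> has_density R Y -> has_density R Z ->
  X `<=` Y `|` Z -> nuS R X <= nuS R Y + nuS R Z.
Proof.
move=> hX hY hZ XYZ; apply/ler_addgt0Pl => e e0; apply: (avg_le_nuS hX).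
have e2 : 0 < e / 2 by rewrite divr_gt0.
apply: avg_le_indic_sub XYZ _ (avg_le_indicU (c := nuS R Y + e / 2) (d := nuS R Z + e / 2) _ _).
- lra.
- by apply: nuS_avg_le; rewrite // ltrDl.
- by apply: nuS_avg_le; rewrite // ltrDl.
Qed.

Lemma nuS_set0 : nuS R set0 = 0.
Proof. by have /null_densityE[] := @dnull_set0 R. Qed.

Variable A : set (set posnat).
Hypothesis dA : density_field R A.
Let fA : set_field A := dA.1.
Let hA : A `<=` has_density R := dA.2.
Local Notation pj := (pj_completion R A).

Lemma nuS_leU_field X Y Z : A X -> A Y -> A Z ->
  X `<=` Y `|` Z -> nuS R X <= nuS R Y + nuS R Z.
Proof. by move=> /hA hX /hA hY /hA hZ; exact: nuS_leU. Qed.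

Lemma nuS_ltU X Y e : A X -> A Y -> nuS R X < e / 2 -> nuS R Y < e / 2 ->
  nuS R (X `|` Y) < e.
Proof.
move=> AX AY Xe Ye; have := nuS_leU_field (set_fieldU fA AX AY) AX AY (@subset_refl _ _).
lra.
Qed.

Lemma subset_pj : A `<=` pj.
Proof. by move=> X AX e e0; exists X, X; split => //; rewrite setDv nuS_set0. Qed.

Lemma pj_has_density : pj `<=` has_density R.
Proof.
move=> X pX; apply: approx_cvgn => e e0; have e4 : 0 < e / 4 by rewrite divr_gt0.
have [B [C [AB AC BX XC BCe]]] := pX _ e4.
exists (nuS R B).
have ACB : A (C `\` B) by exact: set_fieldD.
have CB : avg_le \1_(C `\` B) (e / 4) by apply: nuS_avg_le => //; exact: hA.
have /cvgrPdist_le/(_ _ e4) := cvg_has_density (hA AB).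
apply: filterS2 CB => N CB; rewrite distrC => Bn.
apply: le_trans (ler_distD (avg \1_B N) _ _) _.
suff : `|avg \1_X N - avg \1_B N| <= e / 4 by lra.
apply: le_trans (avg_norm_sub _ _ _) (le_trans _ CB); apply: ler_avg => x.
have [Bx|Bx] := pselect (B x).
  by rewrite (indicT _ (BX _ Bx)) (indicT _ Bx) subrr normr0 indic_ge0.
rewrite (indicF _ Bx) subr0 ger0_norm ?indic_ge0//.
have [Xx|Xx] := pselect (X x); last by rewrite (indicF _ Xx) indic_ge0.
by rewrite !indicT//; split => //; exact: XC.
Qed.

Lemma pj_field : set_field pj.
Proof.
split; first exact/subset_pj/(set_field0 fA).
  move=> X pX e /pX[B [C [AB AC BX XC BCe]]].
  exists (~` C), (~` B); split; [exact: set_fieldC|exact: set_fieldC|exact: subsetC..|].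
  by rewrite setDE setCK setIC -setDE.
move=> X Y pX pY e e0; have e2 : 0 < e / 2 by rewrite divr_gt0.
have [B [C [AB AC BX XC BCe]]] := pX _ e2.
have [B' [C' [AB' AC' BX' XC' BCe']]] := pY _ e2.
exists (B `|` B'), (C `|` C'); split; [exact: set_fieldU|exact: set_fieldU|exact: setUSS..|].
apply: le_lt_trans (nuS_ltU (set_fieldD fA AC AB) (set_fieldD fA AC' AB') BCe BCe').
have AE : A ((C `\` B) `|` (C' `\` B')) by apply: set_fieldU => //; exact: set_fieldD.
rewrite -[leRHS]addr0 -nuS_set0; apply: nuS_leU_field => //; last first.
- by move=> x [[Cx|Cx] /not_orP[nB nB']]; left; [left|right].
- exact: set_field0.
- by apply: set_fieldD => //; exact: set_fieldU.
Qed.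

Lemma pj_density_field : density_field R pj.
Proof. by split; [exact: pj_field|exact: pj_has_density]. Qed.

Lemma pj_cover X e : pj X -> nuS R X < e -> exists D, [/\ A D, X `<=` D & nuS R D < e].
Proof.
move=> pX Xe; have [|B [C [AB AC BX XC BCe]]] := pX (e - nuS R X); first by rewrite subr_gt0.
exists C; split => //; rewrite -ltrBDl in BCe *.
have := nuS_leU (hA AC) (pj_has_density pX) (hA (set_fieldD fA AC AB)).
suff CX : C `<=` X `|` C `\` B by move=> /(_ CX); lra.
by move=> x Cx; have [/BX|Bx] := pselect (B x); [left|right].
Qed.

Lemma measurable1_simple s : simple A s -> measurable1 A s.
Proof.
move=> As e e0; exists s; split => //; exists set0; split.
- exact: set_field0.
- by rewrite nuS_set0.
- by move=> x _; rewrite subrr normr0 ltW.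
Qed.

Lemma measurable1D f g : measurable1 A f -> measurable1 A g -> measurable1 A (f \+ g).
Proof.
move=> mf mg e e0; have e2 : 0 < e / 2 by rewrite divr_gt0.
have [s [As [D [AD De Df]]]] := mf _ e2.
have [t [At [E [AE Ee Eg]]]] := mg _ e2.
exists (fun x => s x + t x); split; first exact: simple_op2.
exists (D `|` E); split; [exact: set_fieldU|exact: nuS_ltU|].
move=> x /not_orP[/Df Dx /Eg Ex]; have := ler_normD (s x - f x) (t x - g x).
by rewrite [X in `|X|](_ : _ = s x + t x - (f x + g x)); [lra|ring].
Qed.

Lemma measurable1_lim f :
  (forall e, 0 < e -> exists g D,
     [/\ measurable1 A g, A D, nuS R D < e & forall x, ~ D x -> `|g x - f x| <= e]) ->
  measurable1 A f.
Proof.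
move=> fg e e0; have e2 : 0 < e / 2 by rewrite divr_gt0.
have [g [D [mg AD De Df]]] := fg _ e2.
have [s [As [E [AE Ee Eg]]]] := mg _ e2.
exists s; split => //; exists (D `|` E).
split; [exact: set_fieldU|exact: nuS_ltU|move=> x /not_orP[/Df Dx /Eg Ex]].
by have := ler_distD (g x) (s x) (f x); lra.
Qed.

Lemma measurable1_tight f e : measurable1 A f -> 0 < e -> exists M D,
  [/\ 0 <= M, A D, nuS R D < e & forall x, ~ D x -> `|f x| <= M].
Proof.
move=> mf e0; have [s [As [D [AD De Df]]]] := mf _ e0.
have [M M0 sM] := simple_bounded As.
exists (M + e), D; split => // [|x /Df]; first by rewrite addr_ge0// ltW.
by have := lerB_normD (f x) (s x - f x); have := sM x; rewrite [f x + _]addrC subrK; lra.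
Qed.

(** A measurable function is essentially bounded up to small sets, so a
    continuous [phi] acts on it as a uniformly continuous function. *)
Lemma measurable1_modulus (phi : R -> R) f e d : continuous phi -> measurable1 A f ->
  0 < e -> 0 < d -> exists D r, [/\ A D, nuS R D < d, 0 < r &
    forall x y, ~ D x -> `|f x - y| <= r -> `|phi (f x) - phi y| <= e].
Proof.
move=> cphi mf e0 d0; have [M [D [M0 AD Dd Df]]] := measurable1_tight mf d0.
have [r r0 rphi] := unif_continuous_ball M cphi e0.
by exists D, r; split => // x y /Df; exact: rphi.
Qed.

Lemma measurable1_comp (phi : R -> R) f : continuous phi -> measurable1 A f ->
  measurable1 A (phi \o f).
Proof.
move=> cphi mf e e0; have e2 : 0 < e / 2 by rewrite divr_gt0.
have [D [r [AD De r0 Dr]]] := measurable1_modulus cphi mf e0 e2.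
have m0 : 0 < Num.min r (e / 2) by rewrite lt_min r0.
have [s [As [E [AE]]]] := mf _ m0; rewrite lt_min => /andP[_ Ee] Es.
exists (phi \o s); split; first exact: simple_op.
exists (D `|` E); split; [exact: set_fieldU|exact: nuS_ltU|].
move=> x /not_orP[Dx /Es]; rewrite le_min => /andP[sr _] /=.
by rewrite distrC; apply: Dr => //; rewrite distrC.
Qed.

Lemma measurable1Z c f : measurable1 A f -> measurable1 A (c \*: f).
Proof.
by move=> mf; apply: (measurable1_comp (phi := *%R c)) => //; exact: mulrl_continuous.
Qed.

Lemma deq_comp (phi : R -> R) f h : continuous phi -> measurable1 A f -> deq f h ->
  deq (phi \o f) (phi \o h).
Proof.
move=> cphi mf fh e e0 d d0; have d2 : 0 < d / 2 by rewrite divr_gt0.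
have [D [r [AD Dd r0 Dr]]] := measurable1_modulus cphi mf e0 d2.
apply: avg_le_indic_sub (avg_le_indicU (nuS_avg_le (hA AD) Dd) (fh _ r0 _ d2)).
  move=> x /= ex; apply: contrapT => /not_orP[Dx /negP]; rewrite -leNgt => fhr.
  by have := Dr _ _ Dx fhr; rewrite leNgt ex.
by rewrite -splitr.
Qed.

Lemma measurable1_null f g : null_function A (g \- f) -> measurable1 A g -> measurable1 A f.
Proof.
move=> /(null_functionP dA) gf mg; apply: measurable1_lim => e e0.
by have [D [AD De Df]] := gf _ _ e0 e0; exists g, D.
Qed.

Lemma null_deq f g : null_function A (f \- g) -> deq f g.
Proof.
move=> /(null_functionP dA) fg e e0 d d0; have [D [AD Dd Df]] := fg _ _ e0 d0.
apply: avg_le_indic_sub (nuS_avg_le (hA AD) Dd) => // x /= ex.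
by apply: contrapT => /Df; rewrite leNgt ex.
Qed.

(** By linearity this concerns one indicator, and a member of the completion
    differs from a member of [A] inside it by a subset of a small set of [A]. *)
Lemma measurable1_simple_pj s : simple pj s -> measurable1 A s.
Proof.
move=> /(simpleP pj_density_field)[v [n [c [B [pB _ _ -> _]]]]] {s v}.
elim: n c B pB => [|n IH] c B pB.
  by under eq_fun do rewrite big_ord0; apply/measurable1_simple/simple_cst.
under eq_fun do rewrite big_ord_recl; apply: measurable1D; last exact: IH.
apply: (measurable1Z (c ord0)); apply: measurable1_lim => e /(pB ord0).
move=> [X [Y [AX AY XB BY XYe]]]; exists \1_X, (Y `\` X); split => //.
- exact/measurable1_simple/simple_indic.
- exact: set_fieldD.
move=> x /not_andP YX; have e0 : 0 <= e.
  by apply: le_trans (nuS_ge0 (hA (set_fieldD fA AY AX))) (ltW XYe).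
have [Xx|Xx] := pselect (X x).
  by rewrite !indicT ?subrr ?normr0//; exact: XB.
have Bx : ~ B ord0 x by move=> /BY Yx; case: YX.
by rewrite !indicF ?subrr ?normr0.
Qed.

Lemma measurable1_pj f : measurable1 pj f -> measurable1 A f.
Proof.
move=> mf; apply: measurable1_lim => e e0.
have [s [ps [D [pD De Df]]]] := mf _ e0.
have [C [AC DC Ce]] := pj_cover pD De.
exists s, C; split => //; first exact: measurable1_simple_pj.
by move=> x Cx; apply: Df => /DC.
Qed.

End measurable_functions.

(** * Measurability through level sets *)

Section levels.
Variable R : realType.
Implicit Types (f g h s : posnat -> R) (X Y D : set posnat) (c d e l M y : R).

(** The jumps of a monotone function are countable: they are separated by
    distinct rationals. *)
Lemma countable_jumps (F : R -> R) : (forall x y, x <= y -> F y <= F x) ->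
  countable [set y | exists2 e, 0 < e & forall d, 0 < d -> e <= F (y - d) - F (y + d)].
Proof.
move=> Fdec; set J := [set y | _].
have qJ (y : J) : exists q : rat, forall d, 0 < d ->
    F (sval y + d) < ratr q < F (sval y - d).
  case: y => y /= /set_mem [e e0 ye].
  pose S := [set F (y + d) | d in [set d | 0 < d]].
  have S0 : S !=set0 by exists (F (y + 1)), 1 => //=.
  have Sub : has_ubound S.
    by exists (F y) => _ [d /= d0 <-]; apply: Fdec; rewrite lerDl ltW.
  have Fsup d : 0 < d -> F (y + d) <= sup S by move=> d0; apply: ub_le_sup => //; exists d.
  have supF d : 0 < d -> sup S + e <= F (y - d).
    move=> d0; rewrite -lerBrDr; apply: ge_sup => // _ [d' /= d'0 <-].
    have m0 : 0 < Num.min d d' by rewrite lt_min d0.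
    have md : F (y - Num.min d d') <= F (y - d) by apply: Fdec; rewrite lerD2l lerN2 ge_min lexx.
    have md' : F (y + d') <= F (y + Num.min d d').
      by apply: Fdec; rewrite lerD2l ge_min lexx orbT.
    by have := ye _ m0; lra.
  have [q] : exists q : rat, ratr q \in `](sup S), (sup S + e)[.
    by apply: rat_in_itvoo; rewrite ltrDl.
  rewrite in_itv/= => /andP[Sq qS]; exists q => d d0.
  by rewrite (le_lt_trans (Fsup _ d0) Sq) (lt_le_trans qS (supF _ d0)).
have /choice[q qP] := qJ.
have qinj (x y : J) : sval x < sval y -> q x <> q y.
  move=> xy qxy; have d0 : 0 < (sval y - sval x) / 2 by rewrite divr_gt0// subr_gt0.
  have /andP[+ _] := qP x _ d0; have /andP[_ +] := qP y _ d0.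
  rewrite qxy (_ : sval y - _ = sval x + (sval y - sval x) / 2); last by field.
  by move=> /lt_trans /[apply]; rewrite ltxx.
apply/countable_injP; exists (fun y => if pselect (J y) is left Jy
   then pickle (q (SigSub (mem_set Jy))) else 0%N).
move=> x y /set_mem Jx /set_mem Jy; case: pselect => // Jx'; case: pselect => // Jy'.
move=> /(pcan_inj pickleK) qxy; apply/eqP; rewrite eq_le !leNgt.
apply/andP; split; apply/negP.
  by move=> /(qinj (SigSub (mem_set Jy')) (SigSub (mem_set Jx'))); rewrite qxy.
by move=> /(qinj (SigSub (mem_set Jx')) (SigSub (mem_set Jy'))); rewrite qxy.
Qed.

Lemma countable_avoid (D : set R) (a b d : R) : countable D -> a < b ->
  exists y, a < y < b /\ forall i : nat, ~ D (y + i%:R * d).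
Proof.
move=> cD ab; pose D' := \bigcup_i ((fun y => y - i%:R * d) @` D).
have cD' : countable D'.
  by apply: bigcup_countable => // i _; apply: card_le_trans cD; exact: card_image_le.
apply: contrapT => none.
have /subset_card_le/sub_countable/(_ cD')/countable_lebesgue_measure0 : (`]a, b[%classic `<=` D').
  move=> y; rewrite /= in_itv/= => aby; apply: contrapT => yD'; apply: none.
  exists y; split => // i Di; apply: yD'; exists i => //; exists (y + i%:R * d) => //.
  by rewrite addrK.
rewrite lebesgue_measure_itv/= lte_fin ab -EFinD => /eqP.
by rewrite eqe subr_eq0 gt_eqF.
Qed.

Definition clamp M y := Num.max (- M) (Num.min y M).

Lemma clamp_id M y : `|y| <= M -> clamp M y = y.
Proof. by rewrite ler_norml => /andP[My yM]; rewrite /clamp min_l// max_r. Qed.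

Lemma clamp_norm M y : 0 <= M -> `|clamp M y| <= M.
Proof.
move=> M0; rewrite ler_norml /clamp le_max lexx/= ge_max ge_min lexx orbT andbT.
by rewrite (le_trans _ M0)// oppr_le0.
Qed.

Lemma clamp_le_norm M y : 0 <= M -> `|clamp M y| <= `|y|.
Proof.
move=> M0; have [yM|My] := leP `|y| M; first by rewrite clamp_id.
by apply: le_trans (ltW My); exact: clamp_norm.
Qed.

Lemma clamp_lip M x y : `|clamp M x - clamp M y| <= `|x - y|.
Proof.
rewrite /clamp; wlog : x y / x <= y => [H|xy].
  by have [/H//|/ltW/H] := leP x y; rewrite distrC (distrC x).
rewrite [leRHS]distrC [leLHS]distrC [leRHS]ger0_norm ?subr_ge0//.
set u := Num.min x M; set v := Num.min y M.
have [uv vu] : u <= v /\ v <= u + (y - x).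
  by rewrite /u /v; case: (leP x M); case: (leP y M) => ? ?; split; lra.
by rewrite ler_norml; case: (leP (- M) u); case: (leP (- M) v) => ? ?;
  apply/andP; split; lra.
Qed.

Lemma clamp_continuous M : continuous (clamp M).
Proof.
move=> x; apply/cvgrPdist_lt => e e0; near=> y.
by apply: le_lt_trans (clamp_lip _ _ _) _; near: y; exact: cvgr_dist_lt.
Unshelve. all: by end_near. Qed.

(** The staircase jumps by [e / 2] at the levels of an arithmetic progression
    that covers the interval from [- M] to [M] and avoids [D]; it only involves
    the sets where [f] exceeds one of these levels. *)
Lemma staircase (C : set (set posnat)) (D : set R) f e M :
  density_field R C -> countable D -> (forall y, ~ D y -> C [set x | y < f x]) ->
  0 < e -> 0 <= M -> exists2 s, simple C s & forall x, `|s x - clamp M (f x)| <= e.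
Proof.
move=> dC cD Cf e0 M0; pose d := e / 2; have d0 : 0 < d by rewrite divr_gt0.
have [y0 [/andP[y0l y0r] y0D]] : exists y, - M - d < y < - M /\ forall i : nat, ~ D (y + i%:R * d).
  by apply: countable_avoid => //; lra.
pose y (k : nat) := y0 + k%:R * d.
pose s k x := y0 + \sum_(i < k) d * \1_[set x | y i < f x] x.
have sE k x : (f x <= y k -> Num.max (f x) y0 <= s k x <= Num.max (f x) y0 + d) /\
              (y k < f x -> s k x = y k).
  elim: k => [|k [IH1 IH2]].
    rewrite /s big_ord0 /y mul0r !addr0; split => // fy.
    by rewrite max_r// lexx lerDl ltW.
  have sS : s k.+1 x = s k x + d * \1_[set x | y k < f x] x by rewrite /s big_ord_recr/= addrA.
  have yS : y k.+1 = y k + d by rewrite /y -natr1 mulrDl mul1r addrA.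
  have yk0 : y0 <= y k by rewrite /y lerDl mulr_ge0// ltW.
  rewrite sS yS; have [fk|kf] := leP (f x) (y k).
    rewrite indicF//=; last by apply/negP; rewrite -leNgt.
    by rewrite mulr0 addr0; split => [_|]; [exact: IH1|lra].
  rewrite indicT// mulr1 (IH2 kf); split => // fy.
  by rewrite max_l; [apply/andP; split; lra|lra].
pose k := Num.truncn ((M - y0) / d).
have [kl kr] : M < y k.+1 /\ y k <= M.
  have q0 : 0 <= (M - y0) / d by rewrite divr_ge0 ?(ltW d0)//; lra.
  have /andP[] := truncn_itv q0; rewrite ler_pdivlMr// ltr_pdivrMr// /y; lra.
have ykS : y k.+1 = y k + d by rewrite /y -natr1 mulrDl mul1r addrA.
exists (s k.+1) => [|x].
  apply: (simple_op (+%R y0)); apply: (simple_sum dC) => i.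
  exact: (simple_op ( *%R d) (simple_indic dC (Cf _ (y0D i)))).
have [s1 s2] := sE k.+1 x; rewrite ler_norml.
have de : e = d + d by rewrite /d; field.
have [fy|yf] := leP (f x) (y k.+1); last first.
  have -> : clamp M (f x) = M.
    by rewrite /clamp min_r ?max_r//; lra.
  by rewrite s2//; apply/andP; split; lra.
have /andP[] := s1 fy; rewrite /clamp; set u := Num.min (f x) M.
have [uf fu] : u <= f x /\ f x <= u + d.
  by rewrite /u; case: (leP (f x) M) => ?; split; lra.
have uM : u <= M by rewrite /u ge_min lexx orbT.
by case: (leP (f x) y0); case: (leP (- M) u) => ? ? ? ?; apply/andP; split; lra.
Qed.

Variable A : set (set posnat).
Hypothesis dA : density_field R A.
Let fA : set_field A := dA.1.
Let hA : A `<=` has_density R := dA.2.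
Local Notation pj := (pj_completion R A).

Lemma nuSD X Y : A X -> A Y -> Y `<=` X -> nuS R (X `\` Y) = nuS R X - nuS R Y.
Proof.
move=> AX AY YX; apply: (cvg_lim (@Rhausdorff R)).
rewrite [avg _](_ : _ = avg \1_X \- avg \1_Y).
  by apply: cvgB; apply: cvg_has_density; exact: hA.
apply/funext => N; rewrite /= -mulrBl -sumrB; congr (_ / _).
apply: eq_bigr => i _; have [Yx|Yx] := pselect (Y (posS i)).
  by rewrite (indicT _ Yx) (indicT _ (YX _ Yx)) indicF ?subrr// => -[].
rewrite (indicF _ Yx) subr0; have [Xx|Xx] := pselect (X (posS i)).
  by rewrite !indicT.
by rewrite !indicF// => -[].
Qed.

(** The level set at [y] is squeezed between level sets of simple functions
    close to [f]; the gap is controlled by the oscillation at [y] of the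
    monotone function [y |-> nu^*(f > y)], hence vanishes off its jumps. *)
Lemma measurable1_levels f : measurable1 A f ->
  exists2 D : set R, countable D & forall y, ~ D y -> pj [set x | y < f x].
Proof.
move=> mf; pose F y := outer_charge R A [set x | y < f x].
have Fle y e : F y < e <-> exists E, [/\ A E, [set x | y < f x] `<=` E & nuS R E < e].
  exact: outer_ltP.
have Fdec x y : x <= y -> F y <= F x.
  move=> xy; apply/ler_addgt0Pl => e e0; apply/ltW/Fle.
  have /Fle[E [AE xE Ee]] : F x < e + F x by rewrite ltrDr.
  by exists E; split => // z /= yz; apply: xE; exact: le_lt_trans yz.
exists [set y | exists2 e, 0 < e & forall d, 0 < d -> e <= F (y - d) - F (y + d)].
  exact: countable_jumps.
move=> y nJ e e0.
have [d d0 Fd] : exists2 d, 0 < d & F (y - d) - F (y + d) < e / 4.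
  apply: contrapT => none; apply: nJ; exists (e / 4); first by rewrite divr_gt0.
  by move=> d d0; rewrite leNgt; apply/negP => Fd; apply: none; exists d.
pose r := Num.min (d / 2) (e / 8).
have r0 : 0 < r by rewrite lt_min !divr_gt0.
have rd : r <= d / 2 by rewrite ge_min lexx.
have re : r <= e / 8 by rewrite ge_min lexx orbT.
have [s [[_ As] [D [AD Dr Ds]]]] := mf _ r0.
pose S1 := [set x | y - r < s x]; pose S2 := [set x | y + r < s x].
have AS1 : A S1 := As [set z | y - r < z].
have AS2 : A S2 := As [set z | y + r < z].
have S21 : S2 `<=` S1 by move=> x; rewrite /S1 /S2 /= => ?; lra.
have sf x : ~ D x -> (s x - f x <= r) /\ (- r <= s x - f x).
  by move=> /Ds; rewrite ler_norml => /andP[].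
have /Fle[E [AE fE Ee]] : F (y - d) < F (y - d) + e / 8 by rewrite ltrDl divr_gt0.
have S1E : nuS R S1 <= nuS R E + nuS R D.
  apply: (nuS_leU_field dA) => // x; rewrite /S1 /= => yx; have [|/sf[sf1 sf2]] := pselect (D x); first by right.
  by left; apply: fE => /=; lra.
have FS2 : F (y + d) <= nuS R S2 + nuS R D.
  have AS2D : A (S2 `|` D) by exact: set_fieldU.
  apply/ler_addgt0Pl => t t0; apply/ltW/Fle; exists (S2 `|` D); split => //.
    move=> x /= yx; have [|/sf[sf1 sf2]] := pselect (D x); first by right.
    by left; rewrite /S2 /=; lra.
  have := nuS_leU_field dA AS2D AS2 AD (@subset_refl _ _); lra.
exists (S2 `\` D), (S1 `|` D); split; [exact: set_fieldD|exact: set_fieldU| | |].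
- by move=> x [+ /sf[sf1 sf2]]; rewrite /S2 /= => yx; lra.
- move=> x /= yx; have [|/sf[sf1 sf2]] := pselect (D x); first by right.
  by left; rewrite /S1 /=; lra.
have AS12 : A (S1 `\` S2) by exact: set_fieldD.
have := nuS_leU_field dA (set_fieldD fA (set_fieldU fA AS1 AD) (set_fieldD fA AS2 AD)) AS12 AD.
rewrite [nuS R (S1 `\` S2)]nuSD// => H; apply: le_lt_trans (H _) _; last by lra.
move=> x [S1D nS2D]; have [Dx|Dx] := pselect (D x); first by right.
by left; case: S1D => // S1x; split => // S2x; apply: nS2D.
Qed.

(** A staircase misses [f] only at large values of [|f|], and these are confined
    to two level sets of small density. *)
Lemma levels_measurable1 (D : set R) f : countable D ->
  (forall y, ~ D y -> pj [set x | y < f x]) ->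
  (forall e, 0 < e -> exists2 M, 0 <= M & avg_le \1_[set x | M < `|f x|] e) ->
  measurable1 A f.
Proof.
move=> cD pf tf; apply: (measurable1_pj dA) => e e0.
have dpj := pj_density_field dA; have fpj := dpj.1.
have e2 : 0 < e / 2 by rewrite divr_gt0.
have [M M0 fM] := tf _ e2.
have [M1 M2] : M < M + 1 /\ - M - 1 < - M by split; lra.
have [y [/andP[My yM] /(_ 0%N)]] := countable_avoid 0 cD M1.
rewrite mul0r addr0 => /(pf) py.
have [z [/andP[Mz zM] /(_ 0%N)]] := countable_avoid 0 cD M2.
rewrite mul0r addr0 => /(pf) pz.
have M3 : 0 <= M + 1 by rewrite addr_ge0.
have [s ps sf] := staircase dpj cD pf e0 M3.
exists s; split => //; exists ([set x | y < f x] `|` ~` [set x | z < f x]).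
have pE : pj ([set x | y < f x] `|` ~` [set x | z < f x]).
  by apply: (set_fieldU fpj) => //; apply: (set_fieldC fpj).
split => //.
  have e2e : e / 2 < e by lra.
  apply: le_lt_trans e2e; apply: avg_le_nuS; first exact: dpj.2.
  apply: avg_le_indic_sub fM => // x [/= yf|/= /negP]; rewrite /= ltr_normr.
    by rewrite (lt_trans My yf).
  by rewrite -leNgt => fz; apply/orP; right; lra.
move=> x /not_orP[/= /negP yf /contrapT/= zf]; rewrite -leNgt in yf.
have := sf x; rewrite clamp_id// ler_norml; apply/andP; split; lra.
Qed.

End levels.

(** * Completeness of the mean *)

Section completeness.
Variable R : realType.
Implicit Types (f g h k s : posnat -> R) (X Y D : set posnat) (c d e l M y : R).

Lemma ler_avg_upto f g N : (forall i, (i < N)%N -> f (posS i) <= g (posS i)) ->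
  avg f N <= avg g N.
Proof.
move=> fg; rewrite /avg ler_wpM2r ?invr_ge0 ?ler0n//.
by apply: ler_sum => i _; exact: fg.
Qed.

Lemma avg_le_finite_support f (B : nat) e :
  (forall x, (B < val x)%N -> f x = 0) -> 0 < e -> avg_le f e.
Proof.
move=> fB e0; pose S := \sum_(i < B) `|f (posS i)|.
have S0 : 0 <= S by exact: sumr_ge0.
have [N0 N0P] : exists N0 : nat, S / e <= N0%:R.
  by exists (Num.truncn (S / e)).+1; apply/ltW/truncnS_gt.
apply: filterS (nbhs_infty_ge (maxn N0.+1 B)) => N /=; rewrite geq_max => /andP[N0N BN].
rewrite /avg ler_pdivrMr ?ltr0n ?(leq_ltn_trans _ N0N)//.
have SN : S <= e * N%:R.
  rewrite mulrC -ler_pdivrMr//; apply: le_trans N0P _; rewrite ler_nat; exact: ltnW.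
apply: le_trans SN; apply: le_trans (ler_norm _) (le_trans (ler_norm_sum _ _ _) _).
rewrite -(subnKC BN) big_split_ord/= [X in _ + X]big1 ?addr0// => i _.
by rewrite fB ?normr0//= ltnS leq_addr.
Qed.

Lemma geom_tail_le (n N : nat) : \sum_(n <= i < N) (2^-1 : R) ^+ i <= 2 * 2^-1 ^+ n.
Proof.
have [nN|Nn] := leqP n N; last first.
  by rewrite big_geq 1?ltnW// mulr_ge0// exprn_ge0// invr_ge0.
suff -> : \sum_(n <= i < N) (2^-1 : R) ^+ i = 2 * 2^-1 ^+ n - 2 * 2^-1 ^+ N.
  by rewrite gerBl mulr_ge0// exprn_ge0// invr_ge0.
rewrite -(subnKC nN); elim: (N - n)%N => [|m IH]; first by rewrite addn0 big_geq// subrr.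
rewrite addnS big_nat_recr ?leq_addr//= IH [2^-1 ^+ (n + m).+1]exprS.
by field.
Qed.

Lemma geom_small e : 0 < e -> exists n : nat, (2^-1 : R) ^+ n < e.
Proof.
move=> e0; have : (2^-1 : R) ^+ n @[n --> \oo] --> (0 : R).
  by apply: cvg_expr; rewrite ger0_norm ?invr_ge0// invf_lt1// ltr1n.
by move=> /cvgr_lt/(_ _ e0)/filter_ex.
Qed.

(** The diagonal argument for the completeness of Marcinkiewicz and Besicovitch
    spaces. Along a subsequence [v] with increments of upper mean at most
    2^-i, the increment number [i] is switched on only beyond a rank [N1 i] from
    which its averages are at most 2^-i; the switched increments then have all
    their averages below 2^-i, and only finitely many of them act at a given
    point. *)
Lemma mean_complete (u : nat -> posnat -> R) :
  (forall e, 0 < e -> exists n0 : nat, forall n m : nat, (n0 <= n)%N -> (n0 <= m)%N ->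
     avg_le (fun x => `|u n x - u m x|) e) ->
  exists k, forall e, 0 < e -> exists n0 : nat, forall n : nat, (n0 <= n)%N ->
     avg_le (fun x => `|u n x - k x|) e.
Proof.
move=> cu.
have pow_gt0 (i : nat) : 0 < (2^-1 : R) ^+ i by rewrite exprn_gt0// invr_gt0.
have /choice[phi phiP] (i : nat) := cu _ (pow_gt0 i).
pose psi (i : nat) := (\sum_(j < i.+1) phi j)%N.
have phi_psi i j : (i <= j)%N -> (phi i <= psi j)%N.
  by rewrite -ltnS => ij; rewrite /psi (bigD1 (Ordinal ij))//= leq_addr.
pose v i := u (psi i); pose t i x := v i.+1 x - v i x.
have /choice[N0 N0P] (i : nat) : exists N0 : nat, forall N, (N0 <= N)%N ->
    avg (fun x => `|t i x|) N <= 2^-1 ^+ i.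
  have [||N0 _ N0P] := phiP i (psi i.+1) (psi i); [exact: phi_psi..|].
  by exists N0 => N /N0P.
pose N1 i := maxn (N0 i) i.
pose tau i x := t i x * (N1 i < val x)%N%:R.
have tau_avg i N : avg (fun x => `|tau i x|) N <= 2^-1 ^+ i.
  have [NN1|N1N] := leqP N (N1 i).
    apply: le_trans (_ : avg (fun=> 0) N <= _); last first.
      by apply: le_trans (avg_cst_le _ _) (ltW (pow_gt0 i)).
    apply: ler_avg_upto => j jN; rewrite /tau/= ltnNge (leq_trans jN NN1)//.
    by rewrite mulr0 normr0.
  apply: le_trans (N0P i N _); last by rewrite (leq_trans _ (ltnW N1N))// leq_maxl.
  apply: ler_avg => x; rewrite /tau normrM; case: (_ < _)%N => /=.
    by rewrite normr1 mulr1.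
  by rewrite normr0 mulr0.
pose k x := v 0%N x + \sum_(0 <= i < val x) tau i x.
have kE x (n N : nat) : (val x <= N)%N -> (n <= N)%N ->
    k x - v n x = \sum_(0 <= i < n) (tau i x - t i x) + \sum_(n <= i < N) tau i x.
  move=> xN nN; have -> : v n x = v 0%N x + \sum_(0 <= i < n) t i x.
    by rewrite telescope_sumr// addrC subrK.
  rewrite [X in _ = X + _]sumrB /k (_ : \sum_(0 <= i < val x) _ = \sum_(0 <= i < N) tau i x); last first.
    rewrite (big_cat_nat (leq0n _) xN)//= [X in _ = _ + X]big_nat_cond.
    rewrite [X in _ = _ + X]big1 ?addr0// => i.
    rewrite andbT => /andP[xi _]; rewrite /tau ltnNge.
    by rewrite (leq_trans xi (leq_maxr _ _)) mulr0.
  by rewrite (big_cat_nat (leq0n _) nN)//=; ring.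
have vk (n : nat) e : 0 < e -> avg_le (fun x => `|v n x - k x|) (e + 2 * 2^-1 ^+ n).
  move=> e0; pose w x := \sum_(0 <= i < n) `|tau i x - t i x|.
  have : avg_le w e.
    apply: (@avg_le_finite_support _ (\sum_(0 <= i < n) N1 i)%N) => // x Bx.
    rewrite /w big_nat_cond big1// => i; rewrite andbT => /andP[_ lin].
    rewrite /tau (leq_ltn_trans _ Bx) ?mulr1 ?subrr ?normr0//.
    by rewrite big_mkord (bigD1 (Ordinal lin))//= leq_addr.
  apply: filterS2 (nbhs_infty_ge n) => N nN we.
  apply: le_trans (lerD we (geom_tail_le n N)).
  apply: (@le_trans _ _ (avg (w \+ (fun x => \sum_(n <= i < N) `|tau i x|)) N)).
    apply: ler_avg_upto => j jN; rewrite distrC (@kE _ n N)//=.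
    by apply: le_trans (ler_normD _ _) _; rewrite lerD// ler_norm_sum.
  rewrite avgD lerD2l avg_sum; exact: ler_sum.
exists k => e e0; have e4 : 0 < e / 4 by rewrite divr_gt0.
have [n ne] := geom_small e4; exists (psi n) => m nm.
have um := phiP n m (psi n) (leq_trans (phi_psi _ _ (leqnn n)) nm) (phi_psi _ _ (leqnn n)).
apply: le_avg_le (avg_leD um (vk n _ e4)) => [x|]; last by lra.
exact: ler_distD.
Qed.

End completeness.

(** * The integral as a limit of averages *)

Section integral.
Variable R : realType.
Implicit Types (f g h k s : posnat -> R) (X Y D : set posnat) (c d e l M y : R).

Lemma cvg_avg_dist f g a b e : avg f @ \oo --> a -> avg g @ \oo --> b ->
  avg_le (fun x => `|f x - g x|) e -> `|a - b| <= e.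
Proof.
move=> fa gb fg; have : `|avg f N - avg g N| @[N --> \oo] --> `|a - b|.
  by apply: cvg_norm; exact: cvgB.
move=> ab; rewrite -(cvg_lim (@Rhausdorff R) ab).
apply: limr_le; first by apply/cvg_ex; exists `|a - b|.
by apply: filterS fg => N; apply: le_trans; exact: avg_norm_sub.
Qed.

Variable A : set (set posnat).
Hypothesis dA : density_field R A.
Let fA : set_field A := dA.1.
Let hA : A `<=` has_density R := dA.2.

Lemma simple_dist f g : simple A f -> simple A g -> simple A (fun x => `|f x - g x|).
Proof. exact: (simple_op2 dA (fun a b => `|a - b|)). Qed.

Lemma determiningP f (u : nat -> posnat -> R) : determining_sequence A f u <->
  [/\ forall n, simple A (u n), hazy_cvg A u f &
    forall e, 0 < e -> exists n0 : nat, forall n m : nat, (n0 <= n)%N -> (n0 <= m)%N ->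
      avg_le (fun x => `|u n x - u m x|) e].
Proof.
split=> -[su hu cu]; split=> //.
- by move=> n; exact/simpleP.
- move=> e e0; have /cvgrPdist_lt/(_ _ e0) := cu.
  move=> [[P Q] /= [[n0 _ nP] [m0 _ mQ]] PQ]; exists (maxn n0 m0) => n m.
  rewrite !geq_max => /andP[n0n _] /andP[_ m0m].
  have := PQ (n, m) (conj (nP _ n0n) (mQ _ m0m)); rewrite /= sub0r normrN.
  have /simpleP-/(_ dA) sn := su n; have /simpleP-/(_ dA) sm := su m.
  move=> /(le_lt_trans (ler_norm _)); apply: avg_le_cvg.
  exact/(simple_integral_cvg dA)/simple_dist.
- by move=> n; exact/simpleP.
- apply/cvgrPdist_le => e /cu[n0 n0P].
  exists ([set n | (n0 <= n)%N], [set n | (n0 <= n)%N]).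
    by split; exact: nbhs_infty_ge.
  move=> [n m] /= [n0n n0m]; rewrite sub0r normrN.
  have sI := simple_integral_cvg dA (simple_dist (su n) (su m)).
  rewrite ger0_norm; first exact: cvg_avg_le sI (n0P _ _ n0n n0m).
  rewrite -(cvg_lim (@Rhausdorff R) sI); apply: limr_ge.
    by apply/cvg_ex; eexists; exact: sI.
  by apply: nearW => N; exact: avg_ge0.
Qed.

(** The values of [w n] on the small set where it is not yet below [e] are
    controlled by one bounded term of the sequence. *)
Lemma hazy_cauchy_null (w : nat -> posnat -> R) :
  (forall n, simple A (w n)) -> hazy_cvg A w (cst 0) ->
  (forall e, 0 < e -> exists n0 : nat, forall n m : nat, (n0 <= n)%N -> (n0 <= m)%N ->
     avg_le (fun x => `|w n x - w m x|) e) ->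
  forall e, 0 < e -> \forall n \near \oo, avg_le (fun x => `|w n x|) e.
Proof.
move=> sw /(hazy_cvgP dA) hw cw e e0; have e4 : 0 < e / 4 by rewrite divr_gt0.
have [n0 n0P] := cw _ e4; have [M M0 wM] := simple_bounded (sw n0).
have M1 : 0 < M + 1 by rewrite ltr_wpDl.
apply: filterS2 (nbhs_infty_ge n0) (hw _ _ e4 (divr_gt0 e4 M1)) => n n0n [D [AD De Dw]].
have aD := avg_leZ M0 (nuS_avg_le (hA AD) De).
have eM : M * (e / 4 / (M + 1)) <= e / 4.
  by rewrite mulrCA ler_piMr ?(ltW e4)// ler_pdivrMr// mul1r lerDl.
apply: le_avg_le (avg_leD (avg_leD (n0P n n0 n0n (leqnn _)) aD) (avg_le_cst (ltW e4))).
  move=> x /=; have [Dx|Dx] := pselect (D x).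
    rewrite indicT// mulr1; have := lerB_dist (w n x) (w n0 x); have := wM x; lra.
  by rewrite indicF// mulr0; have := Dw _ Dx; rewrite subr0; have := normr_ge0 (w n x - w n0 x); lra.
lra.
Qed.

(** The integral of [f] is computed by averaging another function [h]: hazy
    convergence controls [f] up to sets of small outer charge, and says nothing
    about averages, which can be ruined by a set of density zero. *)
Definition mean_approx f h := forall e, 0 < e ->
  exists2 s, near_simple A f e s & avg_le (fun x => `|s x - h x|) e.

Lemma mean_approx_determining f h : mean_approx f h ->
  exists2 u, determining_sequence A f u &
    forall e, 0 < e -> \forall n \near \oo, avg_le (fun x => `|u n x - h x|) e.
Proof.
move=> fh; have /choice[u uP] (n : nat) : exists s, near_simple A f n.+1%:R^-1 s /\
    avg_le (fun x => `|s x - h x|) n.+1%:R^-1.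
  by have [s ns sh] := fh _ (invS_gt0 R n); exists s.
have uh e : 0 < e -> \forall n \near \oo, avg_le (fun x => `|u n x - h x|) e.
  move=> e0; apply: filterS (near_infty_natSinv_lt (PosNum e0)) => n /ltW ne.
  by apply: le_avg_le (uP n).2.
exists u => //; apply/determiningP; split; first by move=> n; exact: (uP n).1.1.
  by apply: near_simple_hazy => // n; exact: (uP n).1.
move=> e e0; have e2 : 0 < e / 2 by rewrite divr_gt0.
have [n0 _ n0P] := uh _ e2; exists n0 => n m n0n n0m.
apply: le_avg_le (avg_leD (n0P n n0n) (n0P m n0m)) => [x|]; last by rewrite -splitr.
by rewrite /= [`|u m x - _|]distrC; exact: ler_distD.
Qed.

(** The averages of [h] are uniformly close to those of the simple functions,
    which converge to the integrals. The value does not depend on the sequence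
    because the difference of two determining sequences tends hazily to 0. *)
Lemma mean_approx_integral f h : mean_approx f h ->
  charge_integrable A f /\ avg h @ \oo --> charge_integral A f.
Proof.
move=> /mean_approx_determining[u du uh]; split; first by exists u.
have /determiningP[su hu cu] := du.
(* every determining sequence of f has mean limit h, not only u *)
have any u' : determining_sequence A f u' ->
    forall e, 0 < e -> \forall n \near \oo, avg_le (fun x => `|u' n x - h x|) e.
  move=> /determiningP[su' hu' cu'] e e0; have e2 : 0 < e / 2 by rewrite divr_gt0.
  have wn : \forall n \near \oo, avg_le (fun x => `|u' n x - u n x|) (e / 2).
    apply: (hazy_cauchy_null (w := fun n x => u' n x - u n x)) => // [n| |d d0].
    - exact: (simple_op2 dA (fun a b => a - b) (su' n) (su n)).
    - apply/(hazy_cvgP dA) => d r d0 r0.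
      have [d2 r2] : 0 < d / 2 /\ 0 < r / 2 by rewrite !divr_gt0.
      move: hu hu' => /(hazy_cvgP dA)/(_ _ _ d2 r2) + /(hazy_cvgP dA)/(_ _ _ d2 r2).
      apply: filterS2 => n [D [AD Dr Df]] [E [AE Er Ef]].
      exists (D `|` E); split; [exact: set_fieldU|exact: (nuS_ltU dA)|].
      move=> x /not_orP[/Df Dx /Ef Ex]; rewrite subr0.
      by have := ler_distD (f x) (u' n x) (u n x); rewrite (distrC (f x)); lra.
    - have d2 : 0 < d / 2 by rewrite divr_gt0.
      have [n0 n0P] := cu _ d2; have [n1 n1P] := cu' _ d2; exists (maxn n0 n1) => n m.
      rewrite !geq_max => /andP[n0n n1n] /andP[n0m n1m].
      apply: le_avg_le (avg_leD (n0P n m n0n n0m) (n1P n m n1n n1m)) => [x|]; last first.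
        by rewrite -splitr.
      have := ler_normB (u' n x - u' m x) (u n x - u m x) => /=.
      rewrite [X in `|X|](_ : _ = u' n x - u n x - (u' m x - u m x)); last by ring.
      by rewrite [leRHS]addrC.
  apply: filterS2 wn (uh _ e2) => n u'u uh'.
  apply: le_avg_le (avg_leD u'u uh') => [x|]; last by rewrite -splitr.
  exact: ler_distD.
have mean_cvg u' : determining_sequence A f u' -> forall e, 0 < e ->
    \forall n \near \oo, avg (u' n) @ \oo --> simple_integral A (u' n) /\
      avg_le (fun x => `|u' n x - h x|) e.
  move=> du' e e0; have /determiningP[su' _ _] := du'.
  by apply: filterS (any _ du' _ e0) => n u'h; split => //; exact: simple_integral_cvg.
have ch : cvgn (avg h).
  apply: approx_cvgn => e e0; have e2 : 0 < e / 2 by rewrite divr_gt0.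
  have /filter_ex[n [uI un]] := mean_cvg u du _ e2.
  exists (simple_integral A (u n)).
  have /cvgrPdist_le/(_ _ e2) := uI; apply: filterS2 un => N un uI'.
  apply: le_trans (ler_distD (avg (u n) N) _ _) _.
  rewrite [e]splitr lerD// distrC//; exact: le_trans (avg_norm_sub _ _ _) un.
have mean_lim u' : determining_sequence A f u' ->
    simple_integral A (u' n) @[n --> \oo] --> limn (avg h).
  move=> du'; apply/cvgrPdist_le => e e0; rewrite /=.
  apply: filterS (mean_cvg u' du' _ e0) => n [uI un]; rewrite distrC.
  exact: cvg_avg_dist uI ch un.
suff -> : charge_integral A f = limn (avg h) by exact: ch.
rewrite /charge_integral; case: xgetP => [v -> /= [u' du' u'v]|/(_ (limn (avg h)))].
  rewrite -(cvg_lim (@Rhausdorff R) u'v); apply: (cvg_lim (@Rhausdorff R)).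
  exact: mean_lim.
by case; exists u => //; exact: mean_lim.
Qed.

(** Truncate at a level [M] where both the tail of [h] and the tail of [f] are
    small: the truncations are bounded, hence close in mean. *)
Lemma mean_approx_unif f h : measurable1 A f -> deq f h -> unif_integrable h ->
  mean_approx f h.
Proof.
move=> mf fh uh e e0; have e4 : 0 < e / 4 by rewrite divr_gt0.
have [M0 [D0 [M00 AD0 D0e D0f]]] := measurable1_tight mf e4.
have [M M0M hM] := unif_integrable_ge M0 uh e4.
have M_ge0 : 0 <= M by exact: le_trans M0M.
have M2 : 0 < 1 + 2 * M by rewrite ltr_pwDl// mulr_ge0.
pose r := e / 8 / (1 + 2 * M).
have r0 : 0 < r by rewrite !divr_gt0.
have rM : r * (1 + 2 * M) = e / 8 by rewrite /r divfK// gt_eqF.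
have re : r <= e / 8.
  by rewrite -rM ler_peMr ?(ltW r0)// lerDl mulr_ge0.
have [s [As [D [AD Dr Ds]]]] := measurable1_comp dA (@clamp_continuous R M) mf r0.
pose s' := clamp M \o s.
have s'f x : ~ D x -> `|s' x - clamp M (f x)| <= r.
  move=> /Ds; apply: le_trans.
  have := clamp_lip M (s x) (clamp M (f x)).
  by rewrite [clamp M (clamp M (f x))]clamp_id ?clamp_norm.
exists s'.
  split; first exact: simple_op.
  exists (D `|` D0); split; first exact: set_fieldU.
    by apply: (nuS_ltU dA) => //; lra.
  move=> x /not_orP[/s'f + /D0f fM0]; rewrite [clamp M (f x)]clamp_id; first by lra.
  exact: le_trans M0M.
pose E := D `|` [set x | r < `|f x - h x|].
have aE : avg_le \1_E (r + r) by apply: avg_le_indicU (fh _ r0 _ r0); exact: nuS_avg_le (hA AD) Dr.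
have aE' : avg_le (fun x => 2 * M * \1_E x) (2 * M * (r + r)) by apply: avg_leZ => //; rewrite mulr_ge0.
have aC : avg_le (fun=> r + r) (r + r) by apply: avg_le_cst; rewrite addr_ge0// ltW.
apply: le_avg_le (avg_leD (avg_leD hM aE') aC) => [x /=|]; last by lra.
have s'h : `|s' x - clamp M (h x)| <= 2 * M * \1_E x + (r + r).
  have [Ex|Ex] := pselect (E x).
    rewrite indicT// mulr1; apply: le_trans (ler_normB _ _) _.
    have := clamp_norm (s x) M_ge0; have := clamp_norm (h x) M_ge0.
    by rewrite /s' /=; lra.
  rewrite indicF// mulr0 add0r; move: Ex => /not_orP[/s'f Dx /negP]; rewrite -leNgt => fhr.
  by have := ler_distD (clamp M (f x)) (s' x) (clamp M (h x)); have := clamp_lip M (f x) (h x); lra.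
have hh : `|clamp M (h x) - h x| <= `|h x| * \1_[set z | M < `|h z|] x.
  have [Mh|hM'] := ltP M `|h x|; last first.
    by rewrite clamp_id// subrr normr0 mulr_ge0// indic_ge0.
  rewrite indicT// mulr1 /clamp ler_norml; have [h0|h0] := leP 0 (h x).
    rewrite ger0_norm// in Mh *; rewrite min_r ?(ltW Mh)// max_r; last by lra.
    by apply/andP; split; lra.
  rewrite ltr0_norm// in Mh *; rewrite min_l; last by lra.
  by rewrite max_l; [apply/andP; split; lra|lra].
by have := ler_distD (clamp M (h x)) (s' x) (h x); lra.
Qed.

Theorem integral_unif f h : measurable1 A f -> deq f h -> unif_integrable h ->
  charge_integrable A f /\ avg h @ \oo --> charge_integral A f.
Proof. by move=> mf fh uh; apply/mean_approx_integral/mean_approx_unif. Qed.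

Lemma integrable_measurable1 f : charge_integrable A f -> measurable1 A f.
Proof. by case=> u [su hu _]; apply/(T1_measurableP dA); exists u. Qed.

(** The mean limit of a determining sequence of [g]; it may differ from [g] on
    a set of density zero, where [g] need not be uniformly integrable. *)
Theorem integrable_unif g : charge_integrable A g ->
  exists2 k, deq g k & unif_integrable k.
Proof.
move=> [u /determiningP[su /(hazy_cvgP dA) hu /mean_complete[k uk]]]; exists k.
  move=> e e0 d d0; have e2 : 0 < e / 2 by rewrite divr_gt0.
  have d2 : 0 < d / 2 by rewrite divr_gt0.
  have [n0 n0P] := uk _ (mulr_gt0 d2 e2).
  have [n1 _ n1P] := hu _ _ e2 d2; pose n := maxn n0 n1.
  have n0n : (n0 <= n)%N by exact: leq_maxl.
  have [D [AD Dd Df]] := n1P n (leq_maxr n0 n1).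
  have := avg_le_markov e2 (n0P n n0n); rewrite mulfK ?gt_eqF// => uk'.
  apply: avg_le_indic_sub (avg_le_indicU (nuS_avg_le (hA AD) Dd) uk'); last first.
    by rewrite -splitr.
  move=> x /= egk; apply: contrapT => /not_orP[/Df Dx /negP]; rewrite -leNgt => ukx.
  move: egk; rewrite ltNge => /negP; apply.
  by have := ler_distD (u n x) (g x) (k x); rewrite (distrC (g x) (u n x)); lra.
move=> e e0; have e2 : 0 < e / 2 by rewrite divr_gt0.
have [n nP] := uk _ e2; have [M M0 uM] := simple_bounded (su n).
exists (2 * M).
apply: le_avg_le (avg_leZ (_ : 0 <= 2) (nP n (leqnn n))) => [x| |//]; last by lra.
have [Mk|Mk] := pselect (2 * M < `|k x|); last by rewrite indicF// mulr0 mulr_ge0.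
rewrite indicT// mulr1.
by have := lerB_dist (k x) (u n x); rewrite distrC; have := uM x; lra.
Qed.

End integral.

(** * The spaces L_p and K_p *)

Section Lp_Kp.
Variable R : realType.
Implicit Types (f g h k s : posnat -> R) (X Y D : set posnat) (c d e l M y : R).

Lemma nu_plus_lt_avg_le f e : (nu_plus f < e%:E)%E -> avg_le f e.
Proof.
move=> /ereal_inf_lt[_ [V VN <-] Ve]; apply: filterS VN => N VN.
rewrite -lee_fin; apply: le_trans (ltW Ve).
by apply: ereal_sup_ubound; exists N.
Qed.

Lemma avg_le_nu_plus_lt f c e : c < e -> avg_le f c -> (nu_plus f < e%:E)%E.
Proof.
move=> ce fc; apply: (@le_lt_trans _ _ c%:E); last by rewrite lte_fin.
apply: (@le_trans _ _ (ereal_sup [set (avg f N)%:E | N in [set N | avg f N <= c]])).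
  by apply: ereal_inf_lbound; exists [set N | avg f N <= c].
by apply: ge_ereal_sup => _ [N /= Nc <-]; rewrite lee_fin.
Qed.

Variable p : R.
Hypothesis p_ge1 : 1 <= p.
Let p_gt0 : 0 < p := lt_le_trans ltr01 p_ge1.

Lemma powR_invK (a : R) : 0 <= a -> (a `^ p^-1) `^ p = a.
Proof. by move=> a0; rewrite -powRrM mulVf ?gt_eqF// powRr1. Qed.

Lemma powR_Kinv (a : R) : 0 <= a -> (a `^ p) `^ p^-1 = a.
Proof. by move=> a0; rewrite -powRrM mulfV ?gt_eqF// powRr1. Qed.

Lemma norm_powR_continuous (q : R) : 0 < q -> continuous (fun x : R => `|x| `^ q).
Proof.
move=> q0 x; have [->|x0] := eqVneq x 0.
  apply/cvgrPdist_lt => e e0; rewrite normr0 powR0 ?gt_eqF//.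
  have r0 : 0 < e `^ q^-1 by exact: powR_gt0.
  apply/nbhs_ballP; exists (e `^ q^-1) => // y; rewrite /ball/= sub0r normrN => yr.
  rewrite sub0r normrN ger0_norm ?powR_ge0//.
  have -> : e = (e `^ q^-1) `^ q by rewrite -powRrM mulVf ?gt_eqF// powRr1// ltW.
  by apply: gt0_ltr_powR => //; rewrite ?nnegrE ?powR_ge0.
have : {for `|x|, continuous (@powR R ^~ q)}.
  apply/differentiable_continuous/derivable1_diffP; apply: derivable_powR.
  by rewrite in_itv/= normr_gt0 x0.
by move=> cx; exact: (cvg_comp _ _ (@norm_continuous _ R^o x) cx).
Qed.

Lemma abs_pow_ge0 h x : 0 <= abs_pow p h x.
Proof. exact: powR_ge0. Qed.

Lemma unif_integrable_abs_pow h : unif_integrable (abs_pow p h) -> unif_integrable h.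
Proof.
move=> uh e e0; have [M M1 hM] := unif_integrable_ge 1 uh e0; exists M.
apply: le_avg_le hM => // x; have [Mh|Mh] := pselect (M < `|h x|); last first.
  by rewrite indicF// mulr0 mulr_ge0// indic_ge0.
have hp : `|h x| <= abs_pow p h x by apply: le1r_powR => //; lra.
rewrite (@indicT _ [set z | M < `|h z|])// (@indicT _ [set z | M < `|abs_pow p h z|])/=.
  by rewrite !mulr1 [leRHS]ger0_norm// abs_pow_ge0.
by rewrite ger0_norm ?abs_pow_ge0//; exact: lt_le_trans Mh hp.
Qed.

Lemma unif_integrable_abs_powD f g : unif_integrable (abs_pow p f) ->
  unif_integrable (abs_pow p g) -> unif_integrable (abs_pow p (f \+ g)).
Proof.
move=> uf ug; pose b x := 2 `^ p * (abs_pow p f x + abs_pow p g x).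
apply: (@unif_integrable_le _ _ b); last exact/unif_integrableZ/unif_integrableD.
move=> x; rewrite ger0_norm ?abs_pow_ge0//.
have b0 : 0 <= b x by rewrite mulr_ge0 ?addr_ge0 ?powR_ge0.
rewrite ger0_norm// /b; pose m := Num.max `|f x| `|g x|.
have m0 : 0 <= m by rewrite le_max normr_ge0.
apply: (@le_trans _ _ (2 `^ p * m `^ p)).
  rewrite -powRM//; apply: ge0_ler_powR; rewrite ?nnegrE ?mulr_ge0 ?(ltW p_gt0)//.
  rewrite mulr_natl mulr2n; apply: le_trans (ler_normD _ _) _.
  by rewrite lerD// le_max lexx ?orbT.
rewrite ler_wpM2l ?powR_ge0// /m /Num.max; case: ifP => _.
  by rewrite lerDr powR_ge0.
by rewrite lerDl powR_ge0.
Qed.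

Lemma unif_integrable_abs_powZ c f : unif_integrable (abs_pow p f) ->
  unif_integrable (abs_pow p (c \*: f)).
Proof.
move=> uf; rewrite (_ : abs_pow p _ = fun x => `|c| `^ p * abs_pow p f x).
  exact: unif_integrableZ.
by apply/funext => x; rewrite /abs_pow /= normrM powRM.
Qed.

Variable A : set (set posnat).
Hypothesis dA : density_field R A.

(** The level sets alone do not make [h] measurable; the tail condition adds
    that [h] is bounded outside sets of small density. *)
Lemma KpP h : Kp A p h <-> measurable1 A h /\ unif_integrable (abs_pow p h).
Proof.
split=> [[[D cD pD] uh]|[mh uh]].
  have uh' : unif_integrable (abs_pow p h).
    move=> e /uh[y y0 /nu_plus_lt_avg_le ye]; exists (y `^ p).
    apply: le_avg_le ye => // x; rewrite ger0_norm ?abs_pow_ge0//.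
    rewrite ler_wpM2l ?abs_pow_ge0//; apply: ler_indic => z /=.
    by rewrite ger0_norm ?abs_pow_ge0.
  split => //; apply: (levels_measurable1 dA cD pD) => e e0.
  have [M M1 hM] := unif_integrable_ge 1 (unif_integrable_abs_pow uh') e0.
  exists M; first by lra.
  apply: le_avg_le hM => // x; have [Mh|Mh] := pselect (M < `|h x|).
    by rewrite !indicT// mulr1; lra.
  by rewrite !indicF// mulr0.
split; first by have [D cD pD] := measurable1_levels dA mh; exists D.
move=> e e0; have e2 : 0 < e / 2 by rewrite divr_gt0.
have [M M1 hM] := unif_integrable_ge 1 uh e2.
have M0 : 0 <= M by lra.
exists (M `^ p^-1); first by rewrite powR_gt0//; lra.
apply: (@avg_le_nu_plus_lt _ (e / 2)); first by lra.
apply: le_avg_le hM => // x.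
rewrite powR_invK// ger0_norm ?abs_pow_ge0// ler_wpM2l ?abs_pow_ge0//.
by apply: ler_indic => z /=; rewrite ger0_norm ?abs_pow_ge0.
Qed.

Lemma abs_pow_integral f h : measurable1 A f -> deq f h -> unif_integrable (abs_pow p h) ->
  charge_integrable A (abs_pow p f) /\
  avg (abs_pow p h) @ \oo --> charge_integral A (abs_pow p f).
Proof.
move=> mf fh uh; apply: (integral_unif dA) => //.
  exact: (measurable1_comp dA (norm_powR_continuous p_gt0) mf).
exact: (deq_comp dA (norm_powR_continuous p_gt0) mf fh).
Qed.

(** To obtain [h], take the mean limit of a determining sequence of [|f|^p] and
    put back the sign of [f]. Conversely, integrability of [|f|^p] is read off
    from the averages of [|h|^p]. *)
Lemma LpP f : Lp A p f <-> measurable1 A f /\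
  exists2 h, deq f h & unif_integrable (abs_pow p h).
Proof.
split=> [[/(T1_measurableP dA) mf intf]|[mf [h fh uh]]]; last first.
  split; first exact/(T1_measurableP dA).
  by have [] := abs_pow_integral mf fh uh.
split => //; have [k fk uk] := integrable_unif dA intf.
pose r (z : R) := `|z| `^ p^-1.
have cr : continuous r by apply: norm_powR_continuous; rewrite invr_gt0.
exists (fun x => if 0 <= f x then r (k x) else - r (k x)).
  have := deq_comp dA cr (integrable_measurable1 dA intf) fk.
  move=> rfk e /rfk; apply: dnullS => x /=.
  rewrite (_ : r (abs_pow p f x) = `|f x|); last first.
    by rewrite /r ger0_norm ?abs_pow_ge0// powR_Kinv.
  case: ifPn => [f0|]; first by rewrite (ger0_norm f0).
  rewrite -ltNge => f0; rewrite (ltr0_norm f0) opprK.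
  by rewrite (_ : - f x - r (k x) = - (f x + r (k x))) ?normrN//; ring.
apply: unif_integrable_le uk => x; rewrite ger0_norm ?abs_pow_ge0// /abs_pow.
rewrite (_ : `|_| = r (k x)); first by rewrite powR_invK.
by case: ifP => _; rewrite ?normrN ger0_norm ?powR_ge0.
Qed.

Lemma LpD f g : Lp A p f -> Lp A p g -> Lp A p (f \+ g).
Proof.
move=> /LpP[mf [h fh uh]] /LpP[mg [k gk uk]]; apply/LpP; split; first exact: (measurable1D dA).
by exists (h \+ k); [exact: deqD|exact: unif_integrable_abs_powD].
Qed.

Lemma LpZ c f : Lp A p f -> Lp A p (c \*: f).
Proof.
move=> /LpP[mf [h fh uh]]; apply/LpP; split; first exact: (measurable1Z dA).
by exists (c \*: h); [exact: deqZ|exact: unif_integrable_abs_powZ].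
Qed.

Lemma KpD f g : Kp A p f -> Kp A p g -> Kp A p (f \+ g).
Proof.
move=> /KpP[mf uf] /KpP[mg ug]; apply/KpP.
by split; [exact: (measurable1D dA)|exact: unif_integrable_abs_powD].
Qed.

Lemma KpZ c f : Kp A p f -> Kp A p (c \*: f).
Proof.
move=> /KpP[mf uf]; apply/KpP.
by split; [exact: (measurable1Z dA)|exact: unif_integrable_abs_powZ].
Qed.

Lemma Kp_norm_Lp_norm f h : Lp A p f -> deq f h -> unif_integrable (abs_pow p h) ->
  Kp_norm p h = Lp_norm A p f.
Proof.
move=> /LpP[mf _] fh uh; rewrite /Kp_norm /Lp_norm /nu.
by have [_ /(cvg_lim (@Rhausdorff R)) ->] := abs_pow_integral mf fh uh.
Qed.

End Lp_Kp.

(** * Isometries of quotients induced by equality almost everywhere *)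

Section quotient_isometry.
Variable R : realType.
Implicit Types (f g h k : posnat -> R) (c : R).

(** The congruences of the vector space of all real functions. *)
Record congruence (q : (posnat -> R) -> (posnat -> R) -> Prop) : Prop := {
  cong_refl : forall f, q f f;
  cong_sym : forall f g, q f g -> q g f;
  cong_trans : forall g f h, q f g -> q g h -> q f h;
  congD : forall f f' g g', q f f' -> q g g' -> q (f \+ g) (f' \+ g');
  congZ : forall c f f', q f f' -> q (c \*: f) (c \*: f') }.

Lemma null_function_sub (A : set (set posnat)) f g : density_field R A ->
  (forall x, `|f x| <= `|g x|) -> null_function A g -> null_function A f.
Proof.
move=> dA fg /(null_functionP dA) g0; apply/(null_functionP dA) => e d e0 d0.
have [D [AD Dd Dg]] := g0 _ _ e0 d0; exists D; split => // x /Dg.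
exact: le_trans.
Qed.

Lemma null_functionD (A : set (set posnat)) f g : density_field R A ->
  null_function A f -> null_function A g -> null_function A (f \+ g).
Proof.
move=> dA /(null_functionP dA) f0 /(null_functionP dA) g0.
apply/(null_functionP dA) => e d e0 d0.
have [e2 d2] : 0 < e / 2 /\ 0 < d / 2 by rewrite !divr_gt0.
have [D [AD Dd Df]] := f0 _ _ e2 d2; have [E [AE Ed Eg]] := g0 _ _ e2 d2.
exists (D `|` E); split; [exact: (set_fieldU dA.1)|exact: (nuS_ltU dA)|].
by move=> x /not_orP[/Df Dx /Eg Ex]; have := ler_normD (f x) (g x) => /=; lra.
Qed.

Lemma null_functionZ (A : set (set posnat)) c f : density_field R A ->
  null_function A f -> null_function A (c \*: f).
Proof.
move=> dA /(null_functionP dA) f0; apply/(null_functionP dA) => e d e0 d0.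
have c1 : 0 < `|c| + 1 by rewrite ltr_wpDl.
have [D [AD Dd Df]] := f0 _ _ (divr_gt0 e0 c1) d0; exists D; split => // x /Df.
rewrite ler_pdivlMr// normrM => fe; apply: le_trans fe.
by rewrite mulrC ler_wpM2l// lerDl.
Qed.

Lemma eq_ae_congruence (A : set (set posnat)) : density_field R A ->
  congruence (@eq_ae R A).
Proof.
move=> dA; split.
- move=> f; apply/(null_functionP dA) => e d e0 d0; exists set0.
  split; [exact: (set_field0 dA.1)|by rewrite nuS_set0|move=> x _].
  by rewrite /= subrr normr0 ltW.
- by move=> f g; apply: null_function_sub => // x /=; rewrite distrC.
- move=> g f h fg gh; apply: null_function_sub (null_functionD dA fg gh) => // x /=.
  by rewrite addrA subrK.
- move=> f f' g g' ff' gg'.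
  apply: null_function_sub (null_functionD dA ff' gg') => // x /=.
  by rewrite (_ : _ + _ - _ = f x - f' x + (g x - g' x))//; ring.
- move=> c f f' ff'; apply: null_function_sub (null_functionZ c dA ff') => // x /=.
  by rewrite scalerBr.
Qed.

Definition subspace (S : set (posnat -> R)) :=
  (forall f g, S f -> S g -> S (f \+ g)) /\ (forall c f, S f -> S (c \*: f)).

Variables E F : fun_space R.
Hypotheses (qE : congruence (fs_eq E)) (qF : congruence (fs_eq F)).
Hypothesis sE : subspace (fs_set E).

Lemma class_of_eq (G : fun_space R) f g : congruence (fs_eq G) ->
  fs_eq G f g -> class_of G f = class_of G g.
Proof.
move=> qG fg; apply/seteqP; split=> h [Gh hf]; split => //.
  exact: cong_trans fg.
by apply: (cong_trans qG hf); exact: cong_sym.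
Qed.

Lemma class_of_inj (G : fun_space R) f g : congruence (fs_eq G) -> fs_set G f ->
  class_of G f = class_of G g -> fs_eq G f g.
Proof.
move=> qG Gf fg; have : class_of G f f by split => //; exact: cong_refl.
by rewrite fg => -[].
Qed.

Lemma quot_addE (G : fun_space R) f g : congruence (fs_eq G) -> fs_set G f -> fs_set G g ->
  quot_add G (class_of G f) (class_of G g) = class_of G (f \+ g).
Proof.
move=> qG Gf Gg; apply/seteqP; split=> [h [Gh [f' [g' [[_ ff] [_ gg] hfg]]]]|h [Gh hfg]].
  by split => //; apply: (cong_trans qG hfg); exact: congD.
by split => //; exists f, g; split => //; split => //; exact: cong_refl.
Qed.

Lemma quot_scaleE (G : fun_space R) c f : congruence (fs_eq G) -> fs_set G f ->
  quot_scale G c (class_of G f) = class_of G (c \*: f).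
Proof.
move=> qG Gf; apply/seteqP; split=> [h [Gh [f' [_ ff] hf]]|h [Gh hf]].
  by split => //; apply: (cong_trans qG hf); exact: congZ.
by split => //; exists f => //; split => //; exact: cong_refl.
Qed.

Hypothesis fs_eq_sub : forall f g, fs_eq E f g -> fs_eq F f g.
Hypothesis fs_eq_inj : forall f g, fs_set E f -> fs_set E g -> fs_eq F f g -> fs_eq E f g.
Hypothesis fs_fwd : forall f, fs_set E f -> exists2 h, fs_set F h & fs_eq F h f.
Hypothesis fs_bwd : forall h, fs_set F h -> exists2 f, fs_set E f & fs_eq F h f.
Hypothesis fs_iso : forall f h, fs_set E f -> fs_set F h -> fs_eq F h f ->
  fs_norm F h = fs_norm E f.

(** The map induced on the quotients by the coarser relation, that of [F]. *)
Definition class_transfer (cl : set (posnat -> R)) : set (posnat -> R) :=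
  [set h | fs_set F h /\ exists2 f, cl f & fs_eq F h f].

Lemma class_transferE f h : fs_set E f -> fs_eq F h f ->
  class_transfer (class_of E f) = class_of F h.
Proof.
move=> Ef hf; apply/seteqP; split=> [k [Fk [f' [Ef' f'f] kf']]|k [Fk kh]].
  split => //; apply: (cong_trans qF kf'); apply: (cong_trans qF (fs_eq_sub f'f)).
  exact: cong_sym.
split => //; exists f; first by split => //; exact: cong_refl.
exact: (cong_trans qF kh).
Qed.

(** On [E] the two relations agree, and each space meets the classes of the other;
    so all the structure is transported by the choice of representatives. *)
Lemma class_transfer_isometric : isometric_iso E F class_transfer.
Proof.
split.
- split.
  + move=> _ [f Ef <-]; have [h Fh hf] := fs_fwd Ef.
    by exists h => //; rewrite (class_transferE Ef hf).
  + move=> c d /set_mem[f Ef <-] /set_mem[g Eg <-].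
    have [h Fh hf] := fs_fwd Ef; have [k Fk kg] := fs_fwd Eg.
    rewrite (class_transferE Ef hf) (class_transferE Eg kg) => /(class_of_inj qF Fh) hk.
    apply: class_of_eq => //; apply: fs_eq_inj => //.
    exact: cong_trans (cong_trans qF (cong_sym qF hf) hk) kg.
  + move=> _ [h Fh <-]; have [f Ef hf] := fs_bwd Fh.
    by exists (class_of E f); [exists f|exact: class_transferE].
- move=> _ _ [f Ef <-] [g Eg <-].
  have [h Fh hf] := fs_fwd Ef; have [k Fk kg] := fs_fwd Eg.
  rewrite quot_addE// (class_transferE Ef hf) (class_transferE Eg kg) quot_addE//.
  by apply: class_transferE; [exact: sE.1|exact: congD].
- move=> c _ [f Ef <-]; have [h Fh hf] := fs_fwd Ef.
  rewrite quot_scaleE// (class_transferE Ef hf) quot_scaleE//.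
  by apply: class_transferE; [exact: sE.2|exact: congZ].
move=> _ [f Ef <-]; have [h Fh hf] := fs_fwd Ef.
rewrite (class_transferE Ef hf) /quot_norm.
have [Ef' f'f] : class_of E f (xget (fun=> 0) (class_of E f)).
  by apply: (@xgetI _ (fun=> 0) _ f); split => //; exact: cong_refl.
have [Fh' h'h] : class_of F h (xget (fun=> 0) (class_of F h)).
  by apply: (@xgetI _ (fun=> 0) _ h); split => //; exact: cong_refl.
apply: fs_iso => //; apply: (cong_trans qF h'h); apply: (cong_trans qF hf).
exact: (fs_eq_sub (cong_sym qE f'f)).
Qed.

End quotient_isometry.

(** * Adjoining the sets of density zero *)

Section null_extension.
Variable R : realType.
Implicit Types (f g h s : posnat -> R) (X Y D : set posnat) (c d e l M y : R).

(** An explicit form of the field generated by [C] and the sets of density zero,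
    see [gen_field_null_extE]. *)
Definition null_ext (C : set (set posnat)) : set (set posnat) :=
  [set X | exists2 B, C B & dnull R ((X `\` B) `|` (B `\` X))].

Lemma null_ext_field (C : set (set posnat)) : set_field C -> set_field (null_ext C).
Proof.
move=> fC; split.
- exists set0; first exact: set_field0.
  by rewrite setDv setUid; exact: dnull_set0.
- move=> X [B CB XB]; exists (~` B); first exact: set_fieldC.
  apply: dnullS XB => x [[Xx /contrapT Bx]|[Bx /contrapT Xx]]; first by right.
  by left.
- move=> X Y [B CB XB] [B' CB' YB']; exists (B `|` B'); first exact: set_fieldU.
  apply: dnullS (dnullU XB YB') => x [[[Xx|Yx] /not_orP[Bx B'x]]|[[Bx|B'x] /not_orP[Xx Yx]]].
  + by left; left.
  + by right; left.
  + by left; right.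
  + by right; right.
Qed.

Lemma sub_null_ext (C : set (set posnat)) : C `<=` null_ext C.
Proof. by move=> X CX; exists X => //; rewrite setDv setUid; exact: dnull_set0. Qed.

Lemma null_ext_sub (C B : set (set posnat)) : set_field B -> C `<=` B ->
  null_density R `<=` B -> null_ext C `<=` B.
Proof.
move=> fB CB NB X [Y CY XY].
have -> : X = (Y `\` (Y `\` X)) `|` (X `\` Y).
  apply/seteqP; split=> x.
    move=> Xx; have [Yx|Yx] := pselect (Y x); last by right.
    by left; split => // -[].
  by move=> [[Yx] /not_andP[//|/contrapT]|[]].
apply: set_fieldU => //; first (apply: set_fieldD => //; first exact: CB).
  by apply/NB/null_densityE; apply: dnullS XY => x; right.
by apply/NB/null_densityE; apply: dnullS XY => x; left.
Qed.

Lemma gen_field_null_extE (C : set (set posnat)) : set_field C ->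
  gen_field (C `|` null_density R) = null_ext C.
Proof.
move=> fC; apply/seteqP; split; last first.
  move=> X CX B [fB /= CNB]; apply: (null_ext_sub fB _ _ CX) => Y HY; apply: CNB.
    by left.
  by right.
move=> X; apply; split; first exact: null_ext_field.
move=> Y [CY|/null_densityE Y0]; first exact: sub_null_ext.
exists set0; first exact: set_field0.
by rewrite setD0 set0D setU0.
Qed.

Variable A : set (set posnat).
Hypothesis dA : density_field R A.
Let fA : set_field A := dA.1.
Let hA : A `<=` has_density R := dA.2.

Lemma null_ext_density_field : density_field R (null_ext A).
Proof.
split; first exact: null_ext_field.
move=> X [B AB XB]; apply: approx_cvgn => e e0; have e2 : 0 < e / 2 by rewrite divr_gt0.
exists (nuS R B); have /cvgrPdist_le/(_ _ e2) := cvg_has_density (hA AB).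
apply: filterS2 (XB _ e2) => N XN BN.
apply: le_trans (ler_distD (avg \1_B N) _ _) _; rewrite [e]splitr lerD//; last by rewrite distrC.
apply: le_trans (avg_norm_sub _ _ _) (le_trans (ler_avg _ _) XN) => x.
have [Bx|Bx] := pselect (B x); have [Xx|Xx] := pselect (X x).
- by rewrite (indicT _ Bx) (indicT _ Xx) subrr normr0 indic_ge0.
- by rewrite (indicT _ Bx) (indicF _ Xx) sub0r normrN normr1 indicT//; right.
- by rewrite (indicF _ Bx) (indicT _ Xx) subr0 normr1 indicT//; left.
- by rewrite (indicF _ Bx) (indicF _ Xx) subrr normr0 indic_ge0.
Qed.

Lemma simple_mono (B C : set (set posnat)) s : B `<=` C -> simple B s -> simple C s.
Proof. by move=> BC [fs Bs]; split => // P; exact/BC/Bs. Qed.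

Lemma measurable1_mono (C : set (set posnat)) f : A `<=` C -> measurable1 A f ->
  measurable1 C f.
Proof.
move=> AC mf e /mf[s [As [D [AD De Df]]]]; exists s; split; first exact: simple_mono As.
by exists D; split => //; exact: AC.
Qed.

Lemma pj_mono (C : set (set posnat)) : A `<=` C -> pj_completion R A `<=` pj_completion R C.
Proof.
move=> AC X pX e /pX[B [B' [AB AB' BX XB' Be]]].
by exists B, B'; split => //; exact: AC.
Qed.

(** A set of density zero lying in the completion has outer charge zero. *)
Lemma deq_null f g : null_density R `<=` pj_completion R A -> deq f g -> eq_ae A f g.
Proof.
move=> NA fg; apply/(null_functionP dA) => e d e0 d0.
have N0 := (null_densityE _ _).2 (fg _ e0).
have [|D [AD fD Dd]] := pj_cover dA (NA _ N0) (e := d); first by rewrite N0.2.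
by exists D; split => // x Dx /=; rewrite leNgt; apply/negP => /fD.
Qed.

(** For measurable functions the two notions of nullity agree, even if sets of
    density zero need not have zero outer charge: the level sets of a simple
    function close to [f] lie in [A], where density and charge coincide. *)
Lemma measurable1_deq0 f : measurable1 A f -> deq f (cst 0) -> null_function A f.
Proof.
move=> mf f0; apply/(null_functionP dA) => e d e0 d0.
pose r := Num.min (e / 4) (d / 8).
have r0 : 0 < r by rewrite lt_min !divr_gt0.
have re : r <= e / 4 by rewrite ge_min lexx.
have rd : r <= d / 8 by rewrite ge_min lexx orbT.
have [s [[_ As] [D [AD Dr Ds]]]] := mf _ r0.
pose S := [set x | e / 2 < `|s x|].
have AS : A S := As [set z | e / 2 < `|z|].
have S_le : nuS R S <= r + r.
  apply: avg_le_nuS; first exact: hA.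
  apply: avg_le_indic_sub (avg_le_indicU (nuS_avg_le (hA AD) Dr) (f0 _ r0 _ r0)) => //.
  move=> x Sx; have [Dx|Dx] := pselect (D x); first by left.
  right; rewrite /= subr0; have := Ds _ Dx; have := lerB_dist (s x) (f x).
  by move: Sx; rewrite /S /=; lra.
exists (S `|` D); split; first exact: set_fieldU.
  by apply: (nuS_ltU dA) => //; lra.
move=> x /not_orP[/negP + /Ds Dx]; rewrite -leNgt => Sx.
by have := lerB_dist (f x) (s x); rewrite distrC; lra.
Qed.

Lemma measurable1_deq_eq_ae f g : measurable1 A f -> measurable1 A g -> deq f g ->
  eq_ae A f g.
Proof.
move=> mf mg fg; apply: measurable1_deq0.
  rewrite (_ : f \- g = f \+ (-1) \*: g); first exact/(measurable1D dA)/(measurable1Z dA).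
  by apply/funext => x; rewrite /= scaleN1r.
by move=> e /fg; apply: dnullS => x /=; rewrite subr0.
Qed.

Lemma avg_le_tight f e : measurable1 A f -> 0 < e ->
  exists2 M, 0 <= M & avg_le \1_[set x | M < `|f x|] e.
Proof.
move=> mf /(measurable1_tight mf)[M [D [M0 AD De Df]]]; exists M => //.
apply: avg_le_indic_sub (nuS_avg_le (hA AD) De) => // x /= Mf.
by apply: contrapT => /Df; rewrite leNgt Mf.
Qed.

End null_extension.

(** * Lifting measurable functions through sets of density zero *)

Section lifting.
Variable R : realType.
Implicit Types (f g h s : posnat -> R) (X Y D : set posnat) (c d e l M y : R).
Variables B C : set (set posnat).
Hypotheses (dB : density_field R B) (dC : density_field R C).
Hypothesis BC : B `<=` null_ext R C.

Lemma simple_lift s : simple B s ->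
  exists2 t, simple C t & dnull R [set x | s x <> t x].
Proof.
move=> /(simpleP dB)[v [n [c [X [BX _ _ -> _]]]]] {s v}.
elim: n c X BX => [|n IH] c X BX.
  exists (cst 0); first by apply: simple_cst => //; exact: dC.1.
  by apply: dnullS (@dnull_set0 R) => x; rewrite /= big_ord0.
have [t Ct tX] := IH (fun k => c (lift ord0 k)) (fun k => X (lift ord0 k)) (fun k => BX _).
have [Y CY XY] := BC (BX ord0).
exists (fun x => c ord0 * \1_Y x + t x).
  exact: (simple_op2 dC (fun a b => c ord0 * a + b) (simple_indic dC CY) Ct).
apply: dnullS (dnullU XY tX) => x /=; apply: contra_notP => /not_orP[nXY /contrapT <-].
rewrite big_ord_recl; congr (_ * _ + _).
have [Xx|Xx] := pselect (X ord0 x); have [Yx|Yx] := pselect (Y x).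
- by rewrite !indicT.
- by case: nXY; left.
- by case: nXY; right.
- by rewrite !indicF.
Qed.

Variables (h : posnat -> R) (J : set R).
Hypotheses (cJ : countable J) (Bh : forall y, ~ J y -> B [set x | y < h x]).
Hypothesis th : forall e, 0 < e -> exists2 M, 0 <= M & avg_le \1_[set x | M < `|h x|] e.

(** The staircases of [h] at step 2^-n on the strip of width [n] are replaced by
    simple functions over [C] equal to them up to density zero. Equality up to
    density zero does not pass to the limit, so each new function is forced to
    stay within 2 * 2^-n of the previous one wherever that one has modulus at
    most n - 2; the correction only acts on a set of density zero, since two
    consecutive staircases are that close there. The sequence then converges
    uniformly on sets of [C] whose complement has arbitrarily small density. *)
Definition glue (n : nat) (a b : R) : R :=
  if `|a| <= n%:R - 2 then a + clamp (2 * 2^-1 ^+ n) (b - a) else b.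

Fixpoint glued (t : nat -> posnat -> R) (n : nat) : posnat -> R :=
  if n is m.+1 then fun x => glue m (glued t m x) (t m.+1 x) else t 0%N.

Let pow_gt0 (n : nat) : 0 < (2^-1 : R) ^+ n.
Proof. by rewrite exprn_gt0// invr_gt0. Qed.

Let pow_le1 (n : nat) : (2^-1 : R) ^+ n <= 1.
Proof. by rewrite exprn_ile1// ?invr_ge0// invf_le1// ler1n. Qed.

Lemma glued_step t n x : `|glued t n x| <= n%:R - 2 ->
  `|glued t n.+1 x - glued t n x| <= 2 * 2^-1 ^+ n /\ `|glued t n.+1 x| <= n.+1%:R - 2.
Proof.
move=> gn; have -> : glued t n.+1 x = glued t n x +
    clamp (2 * 2^-1 ^+ n) (t n.+1 x - glued t n x) by rewrite /= /glue gn.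
set a := glued t n x in gn *; set b := clamp _ _.
have bn : `|b| <= 2 * 2^-1 ^+ n by apply: clamp_norm; rewrite mulr_ge0// ltW.
split; first by rewrite addrAC subrr add0r.
have n1 : (1 <= n)%N.
  rewrite lt0n; apply/eqP => n0; move: gn; rewrite n0 sub0r.
  by have := normr_ge0 a; lra.
have b1 : `|b| <= 1.
  apply: le_trans bn _; rewrite -(prednK n1) exprS mulrA mulfV// mul1r; exact: pow_le1.
by have := ler_normD a b; rewrite -natr1; lra.
Qed.

Lemma glued_close t n m x : `|glued t n x| <= n%:R - 2 -> (n <= m)%N ->
  `|glued t m x| <= m%:R - 2 /\ `|glued t m x - glued t n x| <= 4 * 2^-1 ^+ n.
Proof.
move=> gn nm; suff : `|glued t m x| <= m%:R - 2 /\
    `|glued t m x - glued t n x| <= 2 * \sum_(n <= i < m) 2^-1 ^+ i.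
  move=> [-> /le_trans H]; split => //; apply: H.
  by have := @geom_tail_le R n m; lra.
rewrite -(subnKC nm); elim: (m - n)%N => [|k [IH1 IH2]].
  by rewrite addn0 big_geq// subrr normr0 mulr0.
rewrite addnS big_nat_recr ?leq_addr//= mulrDr.
have [s1 s2] := glued_step IH1; split; first exact: s2.
by have := ler_distD (glued t (n + k) x) (glued t (n + k).+1 x) (glued t n x); lra.
Qed.

Lemma measurable1_lift : exists2 f, measurable1 C f & deq h f.
Proof.
have /choice[s sP] (n : nat) : exists s, simple B s /\
    forall x, `|s x - clamp n%:R (h x)| <= 2^-1 ^+ n.
  by have [s Bs sh] := staircase dB cJ Bh (pow_gt0 n) (ler0n R n); exists s.
have /choice[t tP] (n : nat) : exists t, simple C t /\ dnull R [set x | s n x <> t x].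
  by have [t Ct st] := simple_lift (sP n).1; exists t.
pose g := glued t.
have Cg n : simple C (g n).
  elim: n => [|n IH]; first exact: (tP 0%N).1.
  exact: (simple_op2 dC (glue n) IH (tP n.+1).1).
have clamp_mid n x a : `|a - clamp n%:R (h x)| <= 2^-1 ^+ n -> `|a| <= n%:R - 2 ->
    `|h x| <= n%:R.
  move=> ah an; rewrite leNgt; apply/negP => nh.
  have : `|clamp n%:R (h x)| < n%:R.
    have := lerB_dist (clamp n%:R (h x)) a; rewrite distrC.
    by have := pow_le1 n; lra.
  rewrite /clamp ltr_norml => /andP[].
  have [h0|h0] := leP 0 (h x).
    rewrite ger0_norm// in nh; rewrite min_r ?(ltW nh)// max_r ?ltxx//.
    by rewrite (@le_trans _ _ 0)// oppr_le0.
  rewrite ltr0_norm// in nh; rewrite min_l; last by apply: le_trans (ltW h0) _.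
  by rewrite max_l ?ltxx//; lra.
have gs n : dnull R [set x | g n x <> s n x].
  elim: n => [|n IH]; first by apply: dnullS (tP 0%N).2 => x /= /nesym.
  apply: dnullS (dnullU IH (tP n.+1).2) => x /=; apply: contra_notP.
  move=> /not_orP[/contrapT gn /contrapT st]; rewrite /g /= -/(g n x) gn -st /glue.
  case: ifP => // sn; rewrite clamp_id; first by rewrite addrC subrK.
  have hn := clamp_mid n x _ ((sP n).2 x) sn.
  have := (sP n).2 x; have := (sP n.+1).2 x; rewrite !clamp_id//; last first.
    by apply: le_trans hn _; rewrite ler_nat.
  rewrite exprS; have := ler_distD (h x) (s n.+1 x) (s n x); rewrite (distrC (h x)).
  by have := pow_gt0 n; lra.
(* points of these sets may still move by more than 2 * 2^-n at step n *)
have unlocked e : 0 < e -> \forall n \near \oo, avg_le \1_[set x | n%:R - 2 < `|g n x|] e.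
  move=> e0; have e2 : 0 < e / 2 by rewrite divr_gt0.
  have [M M0 Mh] := th e2.
  apply: filterS (nbhs_infty_ger (M + 3)) => n /= Mn.
  apply: avg_le_indic_sub (avg_le_indicU Mh (gs n _ e2)); last by rewrite -splitr.
  move=> x /= gx; apply: contrapT => /not_orP[/negP + /contrapT gn]; rewrite -leNgt => hM.
  have := (sP n).2 x; have := lerB_dist (s n x) (clamp n%:R (h x)).
  have := clamp_le_norm (h x) (ler0n R n); rewrite gn in gx.
  by have := pow_le1 n; lra.
pose f x := limn (g ^~ x).
have fg n x : `|g n x| <= n%:R - 2 -> `|g n x - f x| <= 4 * 2^-1 ^+ n.
  move=> gn; have cg : cvgn (g ^~ x).
    apply: approx_cvgn => e e0; have e4 : 0 < e / 4 by rewrite divr_gt0.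
    have [k ke] := geom_small e4; pose m := maxn n k; exists (g m x).
    apply: filterS (nbhs_infty_ge m) => i mi.
    have [gm _] := glued_close gn (leq_maxl n k).
    have [_ /le_trans] := glued_close gm mi; apply.
    have : (2^-1 : R) ^+ m <= 2^-1 ^+ k.
      by apply: ler_wiXn2l; rewrite ?invr_ge0 ?invf_le1 ?ler1n// leq_maxr.
    by lra.
  have : `|g n x - g m x| @[m --> \oo] --> `|g n x - f x|.
    by apply: cvg_norm; apply: cvgB => //; exact: cvg_cst.
  move=> dg; rewrite -(cvg_lim (@Rhausdorff R) dg).
  apply: limr_le; first by apply/cvg_ex; eexists; exact: dg.
  apply: filterS (nbhs_infty_ge n) => m nm; rewrite distrC.
  by have [] := glued_close gn nm.
have small e : 0 < e -> \forall n \near \oo, 5 * (2^-1 : R) ^+ n < e.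
  move=> e0; have [k ke] := geom_small (divr_gt0 e0 (ltr0n R 5 : 0 < 5)).
  apply: filterS (nbhs_infty_ge k) => n kn.
  have : (2^-1 : R) ^+ n <= 2^-1 ^+ k.
    by apply: ler_wiXn2l; rewrite ?invr_ge0 ?invf_le1 ?ler1n.
  by move: ke; rewrite ltr_pdivlMr//; lra.
exists f.
  move=> e e0; have e2 : 0 < e / 2 by rewrite divr_gt0.
  have [n0 _ n0P] := filterI (small _ e0) (unlocked _ e2).
  have [ne nU] := n0P _ (leqnn n0).
  have CU := (Cg n0).2 [set z | n0%:R - 2 < `|z|].
  exists (g n0); split => //; exists [set x | n0%:R - 2 < `|g n0 x|]; split => //.
    have e2e : e / 2 < e by lra.
    by apply: le_lt_trans e2e; apply: avg_le_nuS nU; exact: dC.2.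
  move=> x /= /negP; rewrite -leNgt => /fg/le_trans; apply.
  by have := pow_gt0 n0; lra.
move=> e e0 d d0; have d2 : 0 < d / 2 by rewrite divr_gt0.
have [n0 _ n0P] := filterI (small _ e0) (unlocked _ d2).
have [ne nU] := n0P _ (leqnn n0).
apply: avg_le_indic_sub (avg_le_indicU nU (gs n0 _ d2)); last by rewrite -splitr.
move=> x /= hfe; apply: contrapT => /not_orP[/negP + /contrapT gn]; rewrite -leNgt => gx.
have := fg _ _ gx; have := (sP n0).2 x; rewrite gn in gx *.
rewrite clamp_id; last exact: clamp_mid ((sP n0).2 x) gx.
have := ler_distD (s n0 x) (h x) (f x); rewrite (distrC (h x) (s n0 x)); lra.
Qed.

End lifting.

(** * The isomorphism theorem *)

Section isomorphisms.
Variable R : realType.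
Implicit Types (f g h : posnat -> R) (X : set posnat) (e M y : R).
Variable A : set (set posnat).
Hypothesis dA : density_field R A.
Variable p : R.
Hypothesis p_ge1 : 1 <= p.

Let A' := null_ext R A.
Let dA' : density_field R A' := null_ext_density_field dA.
Let AA' : A `<=` A' := @sub_null_ext R A.

Lemma null_density_pj_null_ext : null_density R `<=` pj_completion R A'.
Proof.
move=> X /null_densityE X0; apply: subset_pj; exists set0; first exact: (set_field0 dA.1).
by rewrite setD0 set0D setU0.
Qed.

Lemma Kp_Lp_isometric : null_density R `<=` pj_completion R A ->
  isometric_iso (KpS A p) (LpS A p) (class_transfer (LpS A p)) /\
  (forall h, Kp A p h ->
     class_transfer (LpS A p) (class_of (KpS A p) h) = class_of (LpS A p) h).
Proof.
move=> NA; have qA := eq_ae_congruence dA.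
have KL h : Kp A p h -> Lp A p h.
  move=> /(KpP p_ge1 dA)[mh uh]; apply/(LpP p_ge1 dA); split => //.
  by exists h => //; exact: deq_refl.
split; last first.
  move=> h Kh; apply: (class_transferE (E := KpS A p)) => //=; exact: (cong_refl qA).
apply: (class_transfer_isometric (E := KpS A p) (F := LpS A p) qA qA).
- by split; [exact: (KpD p_ge1 dA)|exact: (KpZ p_ge1 dA)].
- by move=> f g fg; exact fg.
- by move=> f g _ _ fg; exact fg.
- by move=> f /KL Lf; exists f => //; exact: (cong_refl qA).
- move=> h /(LpP p_ge1 dA)[mh [k hk uk]]; have hk' := deq_null dA NA hk.
  exists k => //; apply/(KpP p_ge1 dA); split => //.
  exact: (measurable1_null dA hk' mh).
- move=> f h /(KpP p_ge1 dA)[_ uf] Lh hf; apply/esym.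
  by apply: (Kp_norm_Lp_norm p_ge1 dA) => //; exact: (null_deq dA).
Qed.

Lemma Lp_has_Kp_null_ext f : Lp A p f -> exists2 h, Kp A' p h & deq f h.
Proof.
move=> /(LpP p_ge1 dA)[mf [h fh uh]]; exists h => //; apply/(KpP p_ge1 dA'); split => //.
apply: (measurable1_null dA' (g := f)); last exact: measurable1_mono mf.
exact: (deq_null dA' null_density_pj_null_ext).
Qed.

(** A member of the completion is recovered, up to density zero, from a level
    set of any measurable function equal to its indicator. *)
Lemma pj_null_ext_eq :
  (forall X, pj_completion R A' X -> exists2 f, measurable1 A f & deq (\1_X : posnat -> R) f) ->
  pj_completion R A' = null_ext R (pj_completion R A).
Proof.
move=> lift; apply/seteqP; split=> [X /lift[f mf Xf]|]; last first.
  apply: (null_ext_sub (pj_field dA') _ null_density_pj_null_ext).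
  exact: (pj_mono AA').
have [D cD pD] := measurable1_levels dA mf.
have lt3 : 3^-1 < 2 / 3 :> R by lra.
have [y [/andP[y1 y2] /(_ 0%N)]] := countable_avoid 0 cD lt3.
rewrite mul0r addr0 => /pD pY; exists [set x | y < f x] => //.
have e0 : 0 < 3^-1 :> R by lra.
apply: dnullS (Xf _ e0) => x /= [[Xx /negP]|[yf Xx]].
  by rewrite -leNgt indicT// => fy; rewrite ger0_norm; lra.
by rewrite indicF// sub0r normrN ger0_norm; lra.
Qed.

Lemma indic_Kp X : pj_completion R A' X -> Kp A' p (\1_X : posnat -> R).
Proof.
move=> pX; apply/(KpP p_ge1 dA'); split.
  apply: (measurable1_simple_pj dA').
  exact: (simple_indic (pj_density_field dA') pX).
move=> e e0; exists 1; apply: le_avg_le (avg_le_cst (ltW e0)) => // x.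
rewrite indicF ?mulr0 ?(ltW e0)//= ger0_norm ?powR_ge0// /abs_pow indicE.
case: (x \in X) => /=; first by rewrite normr1 powR1 ltxx.
by rewrite normr0 powR0 ?gt_eqF ?ltr10//; exact: lt_le_trans p_ge1.
Qed.

(** The equality of the two fields enters through the level sets of [h]: they can
    be corrected by sets of density zero so as to lie in the completion of [A]. *)
Lemma measurable1_null_ext_lift h :
  pj_completion R A' = null_ext R (pj_completion R A) -> measurable1 A' h ->
  exists2 f, measurable1 A f & deq h f.
Proof.
move=> pjE mh; have [D cD pD] := measurable1_levels dA' mh.
have sub : pj_completion R A' `<=` null_ext R (pj_completion R A) by rewrite pjE.
have th e : 0 < e -> exists2 M, 0 <= M & avg_le \1_[set x | M < `|h x|] e.
  by move=> e0; exact: (avg_le_tight dA' mh e0).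
have [f mf hf] := measurable1_lift (pj_density_field dA') (pj_density_field dA) sub cD pD th.
by exists f => //; exact: measurable1_pj.
Qed.

Lemma Lp_Kp_isometric : pj_completion R A' = null_ext R (pj_completion R A) ->
  isometric_iso (LpS A p) (KpS A' p) (class_transfer (KpS A' p)) /\
  (forall f h, Lp A p f -> eq_ae A' h f ->
     class_transfer (KpS A' p) (class_of (LpS A p) f) = class_of (KpS A' p) h).
Proof.
move=> pjE; have qA := eq_ae_congruence dA; have qA' := eq_ae_congruence dA'.
have ae_deq f g : eq_ae A' f g -> deq f g by exact: (null_deq dA').
have deq_ae f g : deq f g -> eq_ae A' f g.
  exact: (deq_null dA' null_density_pj_null_ext).
have sub f g : eq_ae A f g -> eq_ae A' f g by move=> /(null_deq dA)/deq_ae.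
split; last first.
  by move=> f h Lf hf; apply: (class_transferE (E := LpS A p)).
apply: (class_transfer_isometric (E := LpS A p) (F := KpS A' p) qA qA').
- by split; [exact: (LpD p_ge1 dA)|exact: (LpZ p_ge1 dA)].
- exact: sub.
- move=> f g /(LpP p_ge1 dA)[mf _] /(LpP p_ge1 dA)[mg _] /ae_deq.
  exact: (measurable1_deq_eq_ae dA).
- by move=> f /Lp_has_Kp_null_ext[h Kh /deq_sym/deq_ae hf]; exists h.
- move=> h /(KpP p_ge1 dA')[mh uh].
  have [f mf hf] := measurable1_null_ext_lift pjE mh.
  exists f; last exact: deq_ae.
  by apply/(LpP p_ge1 dA); split => //; exists h => //; exact: deq_sym.
- move=> f h Lf /(KpP p_ge1 dA')[_ uh] /ae_deq/deq_sym fh.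
  exact: (Kp_norm_Lp_norm p_ge1 dA).
Qed.

End isomorphisms.

Theorem theorem7p15 (R : realType) (A : set (set posnat))
    (A_field : set_field A) (A_density : A `<=` has_density R)
    (p : R) (p_ge1 : 1 <= p) :
  (null_density R `<=` pj_completion R A ->
     exists Phi, isometric_iso (KpS A p) (LpS A p) Phi /\
       (forall h, Kp A p h ->
          Phi (class_of (KpS A p) h) = class_of (LpS A p) h))
  /\
  (let A' := gen_field (A `|` null_density R) in
   (exists Phi, isometric_iso (LpS A p) (KpS A' p) Phi /\
      (forall f, Lp A p f ->
         exists h, [/\ Kp A' p h,
                       eq_ae A' h f,
                       avg (abs_pow p h) N @[N --> \oo]
                         --> charge_integral A' (abs_pow p h),
                       avg h N @[N --> \oo] --> charge_integral A' h
                     & Phi (class_of (LpS A p) f) = class_of (KpS A' p) h]))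
   <->
   pj_completion R A' = gen_field (pj_completion R A `|` null_density R)).
Proof.
have dA : density_field R A by split.
split=> [NA|A'].
  by exists (class_transfer (LpS A p)); exact: Kp_Lp_isometric.
have dA' := null_ext_density_field dA; have pA := pj_field dA.
rewrite /A' !gen_field_null_extE// => {A'}; split=> [[Phi [iso PhiE]]|pjE].
  apply: pj_null_ext_eq => // X pX; have KX := indic_Kp dA p_ge1 pX.
  have [_ _ /(_ (class_of (KpS (null_ext R A) p) \1_X))[|_ [f Lf <-] fX]] := iso_bij iso.
    by exists \1_X.
  have [h [_ hf _ _ fh]] := PhiE f Lf; exists f.
    by have /(LpP p_ge1 dA)[] := Lf.
  apply: (null_deq dA'); have qA' := eq_ae_congruence dA'.
  apply: (cong_trans qA') hf; apply: (class_of_inj (G := KpS (null_ext R A) p) qA' KX).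
  by rewrite -fX.
have [iso isoE] := Lp_Kp_isometric dA p_ge1 pjE.
exists (class_transfer (KpS (null_ext R A) p)); split => // f Lf.
have [h Kh fh] := Lp_has_Kp_null_ext dA p_ge1 Lf.
have [mh uh] := (KpP p_ge1 dA' h).1 Kh.
have hf : eq_ae (null_ext R A) h f.
  by apply: (deq_null dA' (null_density_pj_null_ext dA)); exact: deq_sym.
exists h; split => //.
- by have [] := abs_pow_integral p_ge1 dA' mh (@deq_refl R h) uh.
- have u1 := unif_integrable_abs_pow p_ge1 uh.
  by have [] := integral_unif dA' mh (@deq_refl R h) u1.
- exact: isoE.
Qed.
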